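(* Let $K$ be a field of characteristic $p>0$. Every element of $\mathrm{GA}_2(K)$ whose order is a finite power of $p$ has order dividing $p^2$. Equivalently, every Pascal finite $F\in\mathrm{GA}_2(K)$ satisfies $\tau_K(F)\le p^2$.
   Context: $K[X]=K[X_1,\dots,X_n]$. $\mathrm{GA}_n(K)$ is the group of polynomial automorphisms of affine $n$-space over $K$: an element is a tuple $F=(F_1,\dots,F_n)\in K[X]^n$ that has a two-sided inverse in $K[X]^n$ under the composition $(F\circ G)_i=F_i\circ G=F_i(G_1,\dots,G_n)$; the identity is $\mathrm{Id}=(X_1,\dots,X_n)$. Order means order in this group. For $F\in K[X]^n$ let $\sigma_F\colon K[X]\to K[X]$, $\sigma_F(P)=P\circ F=P(F_1,\dots,F_n)$, and $\Delta_F=\sigma_F-\mathrm{Id}$, i.e. $\Delta_F(P)=P\circ F-P$. For $g\in K[X]$ the Pascal depth of $g$ with respect to $F$ is $\tau_K^F(g)=\min\{m\ge1:\Delta_F^m(g)=0\}$, with value $\infty$ if no such $m$ exists. Set $\tau_K(F)=\max_{1\le i\le n}\tau_K^F(X_i)$ (the Pascal depth of $F$). $F$ is called Pascal finite if $\tau_K(F)<\infty$. *)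

(* Defs.v *)
From HB Require Import structures.
From mathcomp Require Import all_boot all_order all_algebra.
From mathcomp Require Import mpoly.
From mathcomp Require Import boolp.

Set Implicit Arguments.
Unset Strict Implicit.
Unset Printing Implicit Defensive.

Import GRing.Theory.
Local Open Scope ring_scope.

(* Values in {0, 1, 2, ...} U {oo} are encoded in [option nat], with [None]
   standing for oo. *)
Definition natoo := option nat.

Definition leoo (a b : natoo) : bool :=
  match a, b with
  | _, None => true
  | None, Some _ => false
  | Some m, Some n => (m <= n)%N
  end.

Definition maxoo (a b : natoo) : natoo :=
  match a, b with
  | Some m, Some n => Some (maxn m n)
  | _, _ => None
  end.

Definition minpos (P : pred nat) : natoo :=
  if pselect (exists m, (0 < m)%N && P m) is left exP
  then Some (ex_minn exP) else None.

Lemma minposP (P : pred nat) (m : nat) :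
  minpos P = Some m <->
  [/\ (0 < m)%N, P m & forall k, (0 < k)%N -> P k -> (m <= k)%N].
Proof.
rewrite /minpos; case: pselect => [exP|nexP].
- case: ex_minnP => a /andP[a0 Pa] amin; split=> [[<-]|[m0 Pm mmin]].
    by split=> // k k0 Pk; apply: amin; rewrite k0.
  by congr Some; apply/eqP; rewrite eqn_leq mmin // amin // m0.
- split=> // -[m0 Pm _]; case: nexP; exists m.
  by rewrite m0.
Qed.

(* [None] means that x has infinite order. *)
Definition eltorder (G : groupType) (x : G) : natoo :=
  minpos (fun m => (x ^+ m)%g == 1%g).

Section PolynomialMaps.

Variables (K : fieldType) (n : nat).

Definition polymap := n.-tuple {mpoly K[n]}.

Definition polymap_id : polymap := [tuple 'X_i | i < n].

Definition polymap_comp (F G : polymap) : polymap :=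
  [tuple tnth F i \mPo G | i < n].

Definition polymap_invertible (F : polymap) : Prop :=
  exists G : polymap,
    polymap_comp F G = polymap_id /\ polymap_comp G F = polymap_id.

Lemma mPoA (P : {mpoly K[n]}) (F G : polymap) :
  (P \mPo F) \mPo G = P \mPo (polymap_comp F G).
Proof.
rewrite (comp_mpolyE P F) (comp_mpolyE P (polymap_comp F G)) raddf_sum /=.
apply: eq_bigr => m _; rewrite comp_mpolyZ rmorph_prod /=; congr (_ *: _).
by apply: eq_bigr => i _; rewrite rmorphXn /= tnth_mktuple.
Qed.

Lemma polymap_compA : associative polymap_comp.
Proof. by move=> F G H; apply: eq_from_tnth => i; rewrite !tnth_mktuple mPoA. Qed.

Lemma polymap_comp1f : left_id polymap_id polymap_comp.
Proof.
move=> F; apply: eq_from_tnth => i.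
by rewrite !tnth_mktuple comp_mpolyXU -tnth_nth.
Qed.

Lemma polymap_compf1 : right_id polymap_id polymap_comp.
Proof. by move=> F; apply: eq_from_tnth => i; rewrite tnth_mktuple comp_mpoly_id. Qed.

(* Invertibility goes through [asbool] so that GA is a subtype of polymap: two
   automorphisms are equal as soon as their components are. *)
Record GA := MkGA { GAval :> polymap; _ : `[< polymap_invertible GAval >] }.

HB.instance Definition _ := [isSub for GAval].
HB.instance Definition _ := [Choice of GA by <:].

Lemma GA_invertible (F : GA) : polymap_invertible F.
Proof. by apply/asboolP; case: F. Qed.

Lemma GA_id_subproof : `[< polymap_invertible polymap_id >].
Proof. by apply/asboolP; exists polymap_id; rewrite polymap_comp1f. Qed.

Definition GA_id : GA := MkGA GA_id_subproof.

Lemma GA_comp_subproof (F G : GA) : `[< polymap_invertible (polymap_comp F G) >].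
Proof.
apply/asboolP.
have [F' [FF' F'F]] := GA_invertible F; have [G' [GG' G'G]] := GA_invertible G.
exists (polymap_comp G' F'); split.
- by rewrite -polymap_compA (polymap_compA _ G') GG' polymap_comp1f.
- by rewrite -polymap_compA (polymap_compA _ F) F'F polymap_comp1f.
Qed.

Definition GA_comp (F G : GA) : GA := MkGA (GA_comp_subproof F G).

Definition GA_inv_val (F : GA) : polymap := projT1 (cid (GA_invertible F)).

Lemma GA_inv_valP (F : GA) :
  polymap_comp F (GA_inv_val F) = polymap_id /\
  polymap_comp (GA_inv_val F) F = polymap_id.
Proof. exact: projT2 (cid (GA_invertible F)). Qed.

Lemma GA_inv_subproof (F : GA) : `[< polymap_invertible (GA_inv_val F) >].
Proof. by apply/asboolP; exists F; have [] := GA_inv_valP F. Qed.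

Definition GA_inv (F : GA) : GA := MkGA (GA_inv_subproof F).

Lemma GA_compA : associative GA_comp.
Proof. by move=> F G H; apply: val_inj; exact: polymap_compA. Qed.

Lemma GA_comp1f : left_id GA_id GA_comp.
Proof. by move=> F; apply: val_inj; exact: polymap_comp1f. Qed.

Lemma GA_compf1 : right_id GA_id GA_comp.
Proof. by move=> F; apply: val_inj; exact: polymap_compf1. Qed.

Lemma GA_compVf : left_inverse GA_id GA_inv GA_comp.
Proof. by move=> F; apply: val_inj; have [] := GA_inv_valP F. Qed.

Lemma GA_compfV : right_inverse GA_id GA_inv GA_comp.
Proof. by move=> F; apply: val_inj; have [] := GA_inv_valP F. Qed.

HB.instance Definition _ :=
  isGroup.Build GA GA_compA GA_comp1f GA_compf1 GA_compVf GA_compfV.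

Definition Delta (F : polymap) (P : {mpoly K[n]}) : {mpoly K[n]} :=
  (P \mPo F) - P.

Definition pascal_depth_at (F : polymap) (g : {mpoly K[n]}) : natoo :=
  minpos (fun m => iter m (Delta F) g == 0).

(* The base value 0 of the maximum is harmless: depths are at least 1. *)
Definition pascal_depth (F : polymap) : natoo :=
  \big[maxoo/Some 0%N]_(i < n) pascal_depth_at F 'X_i.

Definition pascal_finite (F : polymap) : Prop := pascal_depth F <> None.

End PolynomialMaps.

(* Main.v *)
Require Import Defs.
From mathcomp Require Import all_boot all_order all_algebra.
From mathcomp Require Import mpoly generic_quotient.
From mathcomp Require Import boolp ring zify.

(** Let sigma be the substitution by F and Delta = sigma - 1. In characteristic p,
    Delta^(p^k) = sigma^(p^k) - 1 ([iter_Delta_pchar]), so F is Pascal finite exactly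
    when F^(p^k) = 1 for some k, and its depth is at most p^2 as soon as F^(p^2) = 1.
    It remains to see that F^(p^k) = 1 implies F^(p^2) = 1.

    This follows from the structure of the automorphism group of the plane. The group
    is generated by its affine and its triangular elements ([tame], the theorem of Jung
    and van der Kulk). Write a conjugate of F as a word of minimal length in these
    generators. If the length is at least 2, cyclically consecutive letters never lie
    in the same subgroup, and ping-pong with the degrees of the two components shows
    that F has infinite order ([cyclic_reduction], [ping_pong]). So an element of finite
    order is conjugate to an affine or to a triangular one
    ([finite_order_conjugate]), and for those the claim is a computation with
    unipotent maps ([affine_exponent], [triangular_exponent]).

    Generation is proved by lowering degrees. Let u and w be the components of an
    automorphism, of degrees d * m and d * n with m and n coprime. The point is that m
    or n must be 1 and that the leading form of one component must be a multiple of a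
    power of that of the other ([leading_power]). Otherwise, as X0 and X1 are
    polynomials in u and w, some nonconstant polynomial in u and w has degree 1, after
    a large cancellation of leading forms. Cancellation is limited by the Jacobian. It
    takes place at a point at infinity, where p(u, w) has, apart from its pole, a
    multiplicity r that is at most its weighted degree divided by m * n
    ([dg_mev_ge]). This multiplicity does not increase when the point is blown up,
    and a blow-up that lowers the degree by e per unit of multiplicity also takes e
    from the order at infinity of the Jacobian of the local coordinates, an order that
    stays positive ([dg_ev2_ge]). In total the degree drops by at most
    r * (d + d * m + d * n - 2), so that at least 2 * r of it is left if m and n are at
    least 2; and if r = 0 nothing cancels. About the Jacobian, only its nonvanishing
    enters, so the argument is valid in every characteristic. *)

Set Implicit Arguments.
Unset Strict Implicit.
Unset Printing Implicit Defensive.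
Import Order.TTheory GRing.Theory Num.Theory.
Local Open Scope ring_scope.

Local Notation "x %:F" := (@FracField.tofrac _ x).

(* Sizes are turned into variables before calling lia, since the ring structures
   that they mention come in several convertible forms. *)
Local Ltac slia :=
  intros;
  repeat match goal with
  | H : context [size (polyseq _)] |- _ => revert dependent H
  end;
  repeat match goal with
  | |- context [size (polyseq ?p)] =>
      let n := fresh "n" in move: (size (polyseq p)) => n
  end; lia.

(** * Derivations and degree on a field of fractions *)

Section FractionDerivation.
Variable R : idomainType.
Implicit Types u w : {fraction R}.

Definition fnum u : R := \n_(repr u).
Definition fden u : R := \d_(repr u).

Lemma fden_neq0 u : fden u != 0.
Proof. exact: denom_ratioP. Qed.

Lemma fracE u : u = (fnum u)%:F / (fden u)%:F.
Proof.
have d0 := fden_neq0 u.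
apply: (canRL (mulfK _)); first by rewrite tofrac_eq0.
rewrite /fnum /fden; set x := repr u.
have -> : u = (\pi_({fraction R}) x)%qT by rewrite reprK.
unlock FracField.tofrac; apply: etrans (esym (FracField.pi_mul _ _)) _.
apply/eqmodP; rewrite /= FracField.equivfE /FracField.mulf.
by rewrite !numden_Ratio ?(mulf_neq0, oner_neq0, denom_ratioP) // !mulr1 mulrC.
Qed.

Lemma frac_ind (P : {fraction R} -> Prop) :
  (forall A B, B != 0 -> P (A%:F / B%:F)) -> forall u, P u.
Proof. by move=> H u; rewrite [u]fracE; apply: H; apply: fden_neq0. Qed.

Lemma frac_eqP (A B C D : R) : B != 0 -> D != 0 ->
  (A%:F / B%:F == C%:F / D%:F) = (A * D == C * B).
Proof.
move=> B0 D0.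
by rewrite -[RHS]tofrac_eq !tofracM eqr_div ?tofrac_eq0.
Qed.

Variable d : R -> R.
Hypothesis dD : forall A B, d (A + B) = d A + d B.
Hypothesis dM : forall A B, d (A * B) = d A * B + A * d B.

(** The quotient rule for a chosen representative; by [fderE] it holds for all of
    them. *)
Definition fder u : {fraction R} :=
  (d (fnum u) * fden u - fnum u * d (fden u))%:F / (fden u ^+ 2)%:F.

Lemma fderE A B : B != 0 ->
  fder (A%:F / B%:F) = (d A * B - A * d B)%:F / (B ^+ 2)%:F.
Proof.
move=> B0; rewrite /fder; set u := A%:F / B%:F.
have D0 := fden_neq0 u.
have : A%:F / B%:F == (fnum u)%:F / (fden u)%:F by rewrite -fracE.
rewrite frac_eqP //; set N := fnum u; set D := fden u => /eqP E.
apply/eqP; rewrite frac_eqP ?expf_neq0 //; apply/eqP.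
have dE : d A * D + A * d D = d N * B + N * d B by rewrite -!dM E.
have -> : (d N * D - N * d D) * B ^+ 2
   = (d N * B + N * d B) * D * B - N * B * (d B * D + d D * B) by ring.
by rewrite -dE -E; ring.
Qed.

Lemma fderD u w : fder (u + w) = fder u + fder w.
Proof.
elim/frac_ind: u => A B B0; elim/frac_ind: w => C D D0.
have B0' : B%:F != 0 by rewrite tofrac_eq0.
have D0' : D%:F != 0 by rewrite tofrac_eq0.
rewrite addf_div // -!tofracM -tofracD !fderE ?mulf_neq0 //.
rewrite addf_div ?tofrac_eq0 ?expf_neq0 //; rewrite -!tofracM -tofracD.
apply/eqP; rewrite frac_eqP ?mulf_neq0 ?expf_neq0 ?mulf_neq0 //; apply/eqP.
by rewrite !(dD, dM); ring.
Qed.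

Lemma fderM u w : fder (u * w) = fder u * w + u * fder w.
Proof.
elim/frac_ind: u => A B B0; elim/frac_ind: w => C D D0.
have B0' : B%:F != 0 by rewrite tofrac_eq0.
have D0' : D%:F != 0 by rewrite tofrac_eq0.
rewrite mulf_div -!tofracM !fderE ?mulf_neq0 //.
rewrite !mulf_div addf_div -?tofracM ?tofrac_eq0 ?mulf_neq0 ?expf_neq0 //.
rewrite -?tofracM -tofracD.
apply/eqP; rewrite frac_eqP ?mulf_neq0 ?expf_neq0 ?mulf_neq0 //; apply/eqP.
by rewrite !(dD, dM); ring.
Qed.

Lemma fder_tofrac A : fder A%:F = (d A)%:F.
Proof.
have d1 : d 1 = 0.
  have := dM 1 1; rewrite !mul1r mulr1 => /eqP.
  by rewrite -subr_eq0 opprD addNKr oppr_eq0 => /eqP.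
rewrite -[A%:F]divr1 -tofrac1 fderE ?oner_neq0 // d1 mulr1 mulr0 subr0 expr1n.
by rewrite tofrac1 divr1.
Qed.

End FractionDerivation.

Section FractionDegree.
Variable S : idomainType.
Local Notation R := {poly S}.
Local Notation L := {fraction R}.
Implicit Types u w : L.

(** The opposite of the valuation at infinity; meaningful away from 0 only. *)
Definition dg u : int := (size (fnum u))%:Z - (size (fden u))%:Z.

Lemma dgE (A B : R) : A != 0 -> B != 0 ->
  dg (A%:F / B%:F) = (size A)%:Z - (size B)%:Z.
Proof.
move=> A0 B0; rewrite /dg; set u := _ / _.
have D0 := fden_neq0 u.
have : A%:F / B%:F == (fnum u)%:F / (fden u)%:F by rewrite -fracE.
rewrite frac_eqP // => /eqP E.
have N0 : fnum u != 0.
  apply: contraNneq A0 => N0; move: E; rewrite N0 mul0r => /eqP.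
  by rewrite mulf_eq0 (negPf D0) orbF.
have := congr1 (fun p : R => size p) E; rewrite !size_mul //.
have : (0 < size A)%N by rewrite size_poly_gt0.
have : (0 < size B)%N by rewrite size_poly_gt0.
have : (0 < size (fnum u))%N by rewrite size_poly_gt0.
have : (0 < size (fden u))%N by rewrite size_poly_gt0.
slia.
Qed.

Lemma frac_neq0P u : u != 0 ->
  exists A B : R, [/\ A != 0, B != 0 & u = A%:F / B%:F].
Proof.
elim/frac_ind: u => A B B0 u0; exists A, B; split => //.
by apply: contraNneq u0 => ->; rewrite tofrac0 mul0r.
Qed.

Lemma dg_tofrac (A : R) : A != 0 -> dg A%:F = (size A)%:Z - 1.
Proof.
by move=> A0; rewrite -[A%:F]divr1 -tofrac1 dgE ?oner_neq0 // size_poly1.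
Qed.

Lemma dg_poly_ge0 (A : R) : A != 0 -> 0 <= dg A%:F.
Proof.
by move=> A0; rewrite dg_tofrac //; move: A0; rewrite -size_poly_gt0; slia.
Qed.

Lemma dgM u w : u != 0 -> w != 0 -> dg (u * w) = dg u + dg w.
Proof.
move=> /frac_neq0P[A [B [A0 B0 ->]]] /frac_neq0P[C [D [C0 D0 ->]]].
rewrite mulf_div -!tofracM !dgE ?mulf_neq0 // !size_mul //.
move: A0 B0 C0 D0; rewrite -!size_poly_gt0; slia.
Qed.

Lemma dgD u w k : u + w != 0 ->
  (u != 0 -> dg u <= k) -> (w != 0 -> dg w <= k) -> dg (u + w) <= k.
Proof.
have [->|] := eqVneq u 0; first by rewrite add0r => w0 _; apply.
have [->|] := eqVneq w 0; first by rewrite addr0 => u0 _ H _; apply: H.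
move=> /frac_neq0P[C [D [C0 D0 ->]]] /frac_neq0P[A [B [A0 B0 ->]]].
have uw : A%:F / B%:F + C%:F / D%:F = (A * D + C * B)%:F / (B * D)%:F.
  by rewrite addf_div ?tofrac_eq0 // -!tofracM -tofracD.
rewrite uw => s0 /(_ isT) + /(_ isT).
have {}s0 : A * D + C * B != 0.
  by apply: contraNneq s0 => ->; rewrite tofrac0 mul0r.
rewrite !dgE ?mulf_neq0 //.
have := size_polyD (A * D) (C * B); rewrite !size_mul //.
move: A0 B0 C0 D0; rewrite -!size_poly_gt0; slia.
Qed.

(** A derivation that does not raise the degree of polynomials by more than e
    does not raise the degree of fractions by more than e either. *)
Lemma dg_fder (d : R -> R) (e : int) u :
  (forall A B, d (A * B) = d A * B + A * d B) ->
  (forall A, d A != 0 -> (size (d A))%:Z <= (size A)%:Z + e) ->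
  fder d u != 0 -> dg (fder d u) <= dg u + e.
Proof.
move=> dM de; have [->|] := eqVneq u 0.
  rewrite -tofrac0 fder_tofrac //.
  have -> : d 0 = 0 by have := dM 0 0; rewrite !mulr0 mul0r addr0.
  by rewrite tofrac0 eqxx.
move=> /frac_neq0P[A [B [A0 B0 ->]]]; rewrite fderE // => N0.
have {}N0 : d A * B - A * d B != 0.
  by apply: contraNneq N0 => ->; rewrite tofrac0 mul0r.
rewrite !dgE ?expf_neq0 // expr2 size_mul //.
have := size_polyD (d A * B) (- (A * d B)); rewrite size_polyN.
have : (size (d A * B)%R <= 0)%N \/
       (size (d A * B))%:Z <= (size A)%:Z + (size B)%:Z + e - 1.
  have [->|dA0] := eqVneq (d A) 0; first by left; rewrite mul0r size_poly0.
  right; rewrite size_mul //; have := de A dA0; move: A0 B0 dA0.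
  rewrite -!size_poly_gt0; slia.
have : (size (A * d B)%R <= 0)%N \/
       (size (A * d B))%:Z <= (size A)%:Z + (size B)%:Z + e - 1.
  have [->|dB0] := eqVneq (d B) 0; first by left; rewrite mulr0 size_poly0.
  right; rewrite size_mul //; have := de B dB0; move: A0 B0 dB0.
  rewrite -!size_poly_gt0; slia.
move: A0 B0 N0; rewrite -!size_poly_gt0; slia.
Qed.

End FractionDegree.

(** The ratio A / B is a nonconstant rational function, hence transcendental over
    K. In a relation, after division by the gcd of A and B, the extreme terms make
    first B, then A a constant. *)
Lemma homog_neq0 (K : fieldType) (A B : {poly K}) (Q : {poly K}) :
  A != 0 -> B != 0 -> (forall th, A != th *: B) -> Q != 0 ->
  \sum_(i < (size Q).-1.+1) Q`_i *: (A ^+ i * B ^+ ((size Q).-1 - i)) != 0.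
Proof.
move=> A0 B0 nprop Q0; set e := (size Q).-1.
pose g := gcdp A B; have g0 : g != 0 by rewrite gcdp_eq0 negb_and A0.
have [A1 AE] : exists A1, A = A1 * g.
  by exists (A %/ g); rewrite divpK // dvdp_gcdl.
have [B1 BE] : exists B1, B = B1 * g.
  by exists (B %/ g); rewrite divpK // dvdp_gcdr.
have cop : coprimep B1 A1.
  have := @coprimep_div_gcd _ A B; rewrite A0 => /(_ isT).
  by rewrite -/g {1}AE {1}BE !mulpK // coprimep_sym.
apply/negP => /eqP s0.
have {}s0 : \sum_(i < e.+1) Q`_i *: (A1 ^+ i * B1 ^+ (e - i)) = 0.
  apply: (mulIf (expf_neq0 e g0)); rewrite mul0r -[RHS]s0 mulr_suml.
  apply: eq_bigr => i _; rewrite AE BE !exprMn -scalerAl; congr (_ *: _).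
  have -> : g ^+ e = g ^+ i * g ^+ (e - i) by rewrite -exprD subnKC // -ltnS.
  by ring.
have Qe : Q`_e != 0 by rewrite -lead_coefE lead_coef_eq0.
have B1c : size B1 = 1%N.
  have : B1 %| A1 ^+ e.
    move: s0; rewrite big_ord_recr /= subnn expr0 mulr1.
    move/eqP; rewrite addrC addr_eq0 => /eqP s0.
    rewrite -(dvdpZr _ _ Qe) s0 -scaleN1r dvdpZr ?oppr_eq0 ?oner_eq0 //.
    apply: (big_ind (fun p => B1 %| p)) => [|p q|i _]; rewrite ?dvdp0 //.
      exact: dvdp_add.
    have -> : (e - i = (e - i).-1.+1)%N by rewrite prednK // subn_gt0.
    by rewrite -mul_polyC exprS; do 2!apply: dvdp_mull; apply: dvdp_mulr.
  have := coprimep_expr e cop; rewrite coprimep_sym => c1 d1.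
  by move: c1; rewrite coprimep_sym => /coprimepP/(_ B1 (dvdpp _) d1)/eqp_size->;
     rewrite size_poly1.
have [b b0 B1E] : exists2 b, b != 0 & B1 = b%:P.
  exists B1`_0; last by apply: size1_polyC; rewrite B1c.
  by apply/eqP => b0; have := B1c; rewrite (size1_polyC (eq_leq B1c)) b0 size_poly0.
pose Q' := \poly_(i < e.+1) (Q`_i * b ^+ (e - i)).
have Q'0 : Q' != 0.
  by apply/eqP => /polyP/(_ e)/eqP;
     rewrite coef_poly ltnSn subnn mulr1 coef0 (negPf Qe).
have comp0 : Q' \Po A1 == 0.
  apply/eqP; rewrite -[RHS]s0 comp_polyE.
  transitivity (\sum_(i < e.+1) Q'`_i *: A1 ^+ i).
    rewrite [LHS](big_ord_widen e.+1 (fun i => Q'`_i *: A1 ^+ i)) ?size_poly //.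
    rewrite big_mkcond; apply: eq_bigr => i _; case: ltnP => // le.
    by rewrite nth_default // scale0r.
  apply: eq_bigr => i _; rewrite coef_poly ltn_ord B1E -polyC_exp.
  by rewrite mulrC -mul_polyC -[in RHS]mul_polyC polyCM; ring.
have A1c : (size A1 <= 1)%N.
  by rewrite leqNgt; apply: contraNN Q'0 => lt; rewrite -(comp_poly_eq0 _ lt).
move: (nprop (A1`_0 / b)); rewrite AE BE (size1_polyC A1c) B1E coefC /=.
by rewrite -mul_polyC mulrA -polyCM divfK // eqxx.
Qed.

Lemma horner_homog (K L : fieldType) (f : {rmorphism K -> L}) (Q : {poly K}) a b :
  Q != 0 -> b != 0 -> let e := (size Q).-1 in
  (map_poly f Q).[a / b] =
  (\sum_(i < e.+1) f Q`_i * (a ^+ i * b ^+ (e - i))) / b ^+ e.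
Proof.
move=> Q0 b0 e; apply: (canRL (mulfK _)); first by rewrite expf_neq0.
rewrite horner_coef size_map_poly mulr_suml.
have -> : size Q = e.+1 by rewrite prednK // size_poly_gt0.
apply: eq_bigr => i _; rewrite coef_map exprMn exprVn.
have -> : b ^+ e = b ^+ i * b ^+ (e - i) by rewrite -exprD subnKC // -ltnS.
have bi0 : b ^+ i != 0 by rewrite expf_neq0.
by rewrite /=; field.
Qed.

Section Constants.
Variable K : fieldType.
Local Notation L := {fraction {poly {poly K}}}.

Definition cst : {rmorphism K -> L} :=
  (@FracField.tofrac {poly {poly K}} \o (polyC \o polyC))%FUN.

Lemma dg_cst c : c != 0 -> dg (cst c) = 0.
Proof. by move=> c0; rewrite dg_tofrac ?polyC_eq0 // size_polyC polyC_eq0 c0. Qed.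

(** The residue of u at infinity is the ratio of the leading coefficients of its
    numerator and denominator, an element of K(t). Either it lies in K, or it is
    transcendental over K, and then no polynomial in u drops in degree. *)
Lemma residue_alternative (u : L) : u != 0 -> dg u = 0 ->
  (exists th, u - cst th != 0 -> dg (u - cst th) < 0) \/
  (forall Q : {poly K}, Q != 0 ->
     (map_poly cst Q).[u] != 0 /\ dg (map_poly cst Q).[u] = 0).
Proof.
move=> /frac_neq0P[A [B [A0 B0 uE]]].
rewrite uE dgE // -uE => /eqP; rewrite subr_eq0 => /eqP -[sAB].
set al := lead_coef A; set be := lead_coef B.
have al0 : al != 0 by rewrite lead_coef_eq0.
have be0 : be != 0 by rewrite lead_coef_eq0.
have BF0 : B%:F != 0 by rewrite tofrac_eq0.
have [[th alE]|nprop] := pselect (exists th, al = th *: be).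
  left; exists th; set C := A - th%:P *: B.
  have -> : u - cst th = C%:F / B%:F.
    by rewrite /C -mul_polyC tofracB tofracM mulrBl mulfK // -uE.
  move=> CB0; have C0 : C != 0.
    by apply: contraNneq CB0 => ->; rewrite tofrac0 mul0r.
  rewrite dgE // subr_lt0 ltz_nat ltnNge; apply/negP => le.
  have sC : (size C <= size B)%N.
    apply: leq_trans (size_polyD _ _) _.
    by rewrite size_polyN geq_max sAB leqnn size_scale_leq.
  have : lead_coef C = 0.
    have -> : lead_coef C = C`_(size B).-1.
      by rewrite /lead_coef; congr (_`_ _.-1); apply/eqP; rewrite eqn_leq sC.
    rewrite coefB coefZ -{1}sAB -!/(lead_coef _) -/al -/be alE.
    by rewrite -mul_polyC subrr.
  by move/eqP; rewrite lead_coef_eq0 (negPf C0).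
right=> Q Q0; set e := (size Q).-1; set s := (size B).-1.
have sB : size B = s.+1 by rewrite prednK // size_poly_gt0.
pose N := \sum_(i < e.+1) (Q`_i)%:P *: (A ^+ i * B ^+ (e - i)).
have QE : (map_poly cst Q).[u] = N%:F / (B ^+ e)%:F.
  rewrite uE horner_homog // tofracXn; congr (_ / _).
  rewrite /N rmorph_sum; apply: eq_bigr => i _.
  by rewrite -mul_polyC !rmorphM !rmorphXn.
have sterm i : (i <= e)%N -> size (A ^+ i * B ^+ (e - i)) = (e * s).+1.
  move=> ie; have le1 k (p : {poly {poly K}}) : p != 0 -> (0 < size (p ^+ k))%N.
    by move=> p0; rewrite size_poly_gt0 expf_neq0.
  rewrite size_mul ?expf_neq0 //.
  have := size_exp A i; have := size_exp B (e - i); rewrite sAB sB /=.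
  have -> : (e * s = s * i + s * (e - i))%N by rewrite -mulnDr subnKC // mulnC.
  have := le1 i A A0; have := le1 (e - i)%N B B0.
  move: (s * i)%N (s * (e - i))%N; slia.
have Nes : N`_(e * s) != 0.
  have -> : N`_(e * s) = \sum_(i < e.+1) Q`_i *: (al ^+ i * be ^+ (e - i)).
    rewrite coef_sum; apply: eq_bigr => i _; rewrite coefZ mul_polyC.
    congr (_ *: _); rewrite /al /be -!lead_coef_exp -lead_coefM lead_coefE.
    by rewrite sterm // -ltnS.
  by apply: homog_neq0 => // th; apply/eqP => alE; apply: nprop; exists th.
have N0 : N != 0 by apply: contraNneq Nes => ->; rewrite coef0.
have sN : size N = (e * s).+1.
  apply/eqP; rewrite eqn_leq; apply/andP; split; last first.
    by rewrite ltnNge; apply: contra Nes => /leq_sizeP/(_ _ (leqnn _))->.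
  apply: leq_trans (size_sum _ _ _) _; apply/bigmax_leqP => i _.
  by apply: leq_trans (size_scale_leq _ _) _; rewrite sterm // -ltnS.
rewrite QE; split; first by rewrite mulf_neq0 ?invr_eq0 ?tofrac_eq0 ?expf_neq0.
rewrite dgE ?expf_neq0 // sN.
have := size_exp B e; have : (0 < size (B ^+ e))%N.
  by rewrite size_poly_gt0 expf_neq0.
rewrite sB /= mulnC; move: (e * s)%N; slia.
Qed.

End Constants.

(** * Polynomials in two variables *)

Lemma ord2 (i : 'I_2) : i = 0 \/ i = 1.
Proof. by case: i => -[|[|k]] hk //; [left|right]; apply: val_inj. Qed.

Lemma lift01 : lift ord0 ord0 = 1 :> 'I_2.
Proof. exact: val_inj. Qed.

Section Bivariate.
Variable K : fieldType.
Implicit Types (P : {poly {poly K}}) (q : {poly K}).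

Lemma poly_lowest (R : nzRingType) (q : {poly R}) : q != 0 ->
  exists e (q1 : {poly R}), q = q1 * 'X^e /\ q1`_0 != 0.
Proof.
move=> q0; have ex : exists e, q`_e != 0.
  by exists (size q).-1; rewrite -lead_coefE lead_coef_eq0.
case: (ex_minnP ex) => e qe emin; exists e, (drop_poly e q).
split; last by rewrite coef_drop_poly.
rewrite -{1}(poly_take_drop e q); suff -> : take_poly e q = 0 by rewrite add0r.
apply/polyP => k; rewrite coef_take_poly coef0; case: ltnP => // ke.
by apply/eqP; apply: contraLR ke => /emin; rewrite -leqNgt.
Qed.

(** A root th other than 0 has multiplicity at most the width of the support:
    the largest power of X that divides q does not vanish at th, and the quotient
    has that width as its degree. *)
Lemma shift_lowest q th : q != 0 -> th != 0 ->
  exists e w r, [/\ q`_e != 0, q`_(e + w) != 0, (r <= w)%N &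
    (q \Po ('X + th%:P))`_r != 0].
Proof.
move=> q0 th0; have [e [q1 [qE q10]]] := poly_lowest q0.
have q1n : q1 != 0 by apply: contraNneq q10 => ->; rewrite coef0.
set s := 'X + th%:P; have s2 : (1 < size s)%N by rewrite size_XaddC.
have q1s : q1 \Po s != 0 by rewrite comp_poly_eq0.
have [r [q2 [q2E q20]]] := poly_lowest q1s.
have ssz : size (q1 \Po s) = size q1.
  by have := size_comp_poly2 q1 (size_XaddC th); apply.
exists e, (size q1).-1, r; split.
- by rewrite qE coefMXn ltnn subnn.
- by rewrite qE coefMXn ltnNge leq_addr /= addKn -lead_coefE lead_coef_eq0.
- have q2n : q2 != 0 by apply: contraNneq q20 => ->; rewrite coef0.
  move: ssz; rewrite q2E size_mulXn // => <-.
  by rewrite -ltnS prednK ?addn_gt0 ?size_poly_gt0 ?q2n ?orbT //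
             -{1}[r]addn0 -addnS leq_add2l size_poly_gt0.
rewrite qE comp_polyM rmorphXn /= comp_polyX q2E -mulrAC coefMXn ltnn subnn.
rewrite coef0M mulf_neq0 //.
by rewrite -horner_coef0 horner_exp hornerD hornerX hornerC add0r expf_neq0.
Qed.
End Bivariate.

Section Blow.
Variable K : fieldType.
Implicit Types (P : {poly {poly K}}) (q : {poly K}).

Lemma commr_mul (A B : comNzRingType) (f : A -> B) (b : B) : commr_rmorph f b.
Proof. by move=> x; apply: mulrC. Qed.

(** Substitution in a polynomial in two variables: [ev2 f a b P] is P at S = a
    for the outer variable S and T = b for the inner variable T. *)
Definition ev1 (A : comNzRingType) (f : {rmorphism K -> A}) (b : A) :
  {rmorphism {poly K} -> A} := horner_morph (commr_mul f b).

Definition ev2 (A : comNzRingType) (f : {rmorphism K -> A}) (a b : A) :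
  {rmorphism {poly {poly K}} -> A} := horner_morph (commr_mul (ev1 f b) a).

Lemma ev1C (A : comNzRingType) (f : {rmorphism K -> A}) b c :
  ev1 f b c%:P = f c.
Proof. exact: horner_morphC. Qed.

Lemma ev1X (A : comNzRingType) (f : {rmorphism K -> A}) b : ev1 f b 'X = b.
Proof. exact: horner_morphX. Qed.

Lemma ev2C (A : comNzRingType) (f : {rmorphism K -> A}) a b q :
  ev2 f a b q%:P = ev1 f b q.
Proof. exact: horner_morphC. Qed.

Lemma ev2X (A : comNzRingType) (f : {rmorphism K -> A}) a b : ev2 f a b 'X = a.
Proof. exact: horner_morphX. Qed.

Lemma bipoly_rmorph_eq (A : pzRingType) (f g : {rmorphism {poly {poly K}} -> A}) :
  (forall c, f c%:P%:P = g c%:P%:P) -> f 'X%:P = g 'X%:P -> f 'X = g 'X ->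
  f =1 g.
Proof.
move=> fgC fgY fgX; have fg1 q : f q%:P = g q%:P.
  elim/poly_ind: q => [|q c IH]; first by rewrite !polyC0 !rmorph0.
  by rewrite polyCD polyCM !rmorphD !rmorphM /= IH fgY fgC.
elim/poly_ind => [|P q IH]; first by rewrite !rmorph0.
by rewrite !rmorphD !rmorphM /= IH fgX fg1.
Qed.

Definition polyCC : {rmorphism K -> {poly {poly K}}} := (polyC \o polyC)%FUN.

(** The pull-back along the chart (S, T) |-> (S, S * T) of a blow-up. *)
Definition blowup : {rmorphism {poly {poly K}} -> {poly {poly K}}} :=
  ev2 polyCC 'X ('X * 'X%:P).

Lemma ev2_blowup (A : comNzRingType) (f : {rmorphism K -> A}) a b P :
  ev2 f a (a * b) P = ev2 f a b (blowup P).
Proof.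
apply: (bipoly_rmorph_eq (f := ev2 f a (a * b)) (g := (ev2 f a b \o blowup)%FUN)) => [c||] /=.
- by rewrite !ev2C !ev1C ev2C ev1C.
- by rewrite !ev2C !ev1X rmorphM /= ev2X ev2C ev1X.
by rewrite !ev2X.
Qed.

Lemma coef_blowup_inner q k :
  (ev1 polyCC ('X * 'X%:P) q)`_k = q`_k *: 'X^k.
Proof.
elim/poly_ind: q k => [|q c IH] k; first by rewrite rmorph0 !coef0 scale0r.
rewrite rmorphD rmorphM ev1X ev1C !coefD mulrA coefMC !coefMX IH !coefC.
case: k => [|k] /=.
  by rewrite mul0r expr0 !add0r alg_polyC.
by rewrite !addr0 -scalerAl -exprSr.
Qed.

Lemma coef_blowup P k j :
  (blowup P)`_k`_j = if (j <= k)%N then P`_(k - j)`_j else 0.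
Proof.
have -> : blowup P = \sum_(i < size P) ev1 polyCC ('X * 'X%:P) P`_i * 'X^i.
  rewrite -{1}[P]coefK poly_def rmorph_sum; apply: eq_bigr => i _.
  by rewrite -mul_polyC rmorphM rmorphXn /blowup ev2C ev2X.
rewrite !coef_sum.
transitivity (\sum_(i < size P)
    (if ((i : nat) == k - j)%N then (if (j <= k)%N then P`_i`_j else 0) else 0)).
  apply: eq_bigr => i _; rewrite coefMXn; case: (ltnP k i) => ki.
    rewrite coef0; case: eqP => // iE; case: leqP => // jk.
    by move: ki; rewrite iE ltnNge leq_subr.
  rewrite coef_blowup_inner coefZ coefXn.
  have [jE|jne] := eqVneq j (k - i)%N.
    by rewrite jE leq_subr subKn // eqxx mulr1.
  rewrite mulr0; case: eqP => // iE; case: leqP => // jk.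
  by move: jne; rewrite iE subKn // eqxx.
rewrite -big_mkcond /=; have [lt|ge] := ltnP (k - j) (size P).
  by rewrite (big_pred1 (Ordinal lt)).
rewrite big_pred0 => [|i]; first by rewrite [P`_(k - j)]nth_default // coef0 if_same.
by apply/negP => /eqP iE; move: (ltn_ord i); rewrite iE ltnNge ge.
Qed.

(** After a blow-up, the exceptional divisor splits off with the multiplicity
    at the origin, and this multiplicity bounds the degree of what is left
    along the exceptional divisor. *)
Lemma strict_transform P i j : P`_i`_j != 0 ->
  exists r (P1 : {poly {poly K}}),
    [/\ (r <= i + j)%N, P1`_0 != 0, (size (P1`_0)%R <= r.+1)%N &
      forall (A : comNzRingType) (f : {rmorphism K -> A}) (a b : A),
        ev2 f a (a * b) P = a ^+ r * ev2 f a b P1].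
Proof.
move=> Pij; have bPij : (blowup P)`_(i + j)`_j != 0.
  by rewrite coef_blowup leq_addl addnK.
have b0 : blowup P != 0 by apply: contraNneq bPij => ->; rewrite !coef0.
have [r [P1 [bE P10]]] := poly_lowest b0.
have P10E k : P1`_0`_k = if (k <= r)%N then P`_(r - k)`_k else 0.
  by rewrite -coef_blowup bE coefMXn ltnn subnn.
exists r, P1; split => //.
- rewrite leqNgt; apply: contra bPij => lt.
  by rewrite bE coefMXn lt coef0.
- by apply/leq_sizeP => k rk; rewrite P10E leqNgt rk.
move=> A f a b; rewrite ev2_blowup bE rmorphM rmorphXn /= ev2X.
exact: mulrC.
Qed.

Definition shift (th : K) : {rmorphism {poly {poly K}} -> {poly {poly K}}} :=
  map_poly (comp_poly ('X + th%:P)).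

Lemma ev2_shift (A : comNzRingType) (f : {rmorphism K -> A}) a b th P :
  ev2 f a b (shift th P) = ev2 f a (b + f th) P.
Proof.
apply: (bipoly_rmorph_eq (f := (ev2 f a b \o shift th)%FUN) (g := ev2 f a (b + f th))) => [c||] /=.
- by rewrite map_polyC /= comp_polyC !ev2C !ev1C.
- by rewrite map_polyC /= comp_polyX !ev2C rmorphD /= !ev1X ev1C.
by rewrite map_polyX !ev2X.
Qed.

Lemma coef_shift th P i : (shift th P)`_i = P`_i \Po ('X + th%:P).
Proof. by rewrite coef_map. Qed.

End Blow.

(** * Degree bounds in the function field of the plane *)

(** L stands for the function field K(t, s), dg for the degree in s, and D1, D2 for
    the derivatives in s and in t. With x = t * s and y = s, dg is the total degree
    in x and y. *)
Section DegreeField.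
Variables (K L : fieldType) (f : {rmorphism K -> L}) (dg : L -> int).
Variables (D1 D2 : L -> L).
Implicit Types (u w a b : L) (c th : K) (k l : int).
Implicit Types (P : {poly {poly K}}) (q : {poly K}).
Hypothesis dgM : forall u w : L, u != 0 -> w != 0 -> dg (u * w) = dg u + dg w.
Hypothesis dgD : forall (u w : L) (k : int), u + w != 0 ->
  (u != 0 -> dg u <= k) -> (w != 0 -> dg w <= k) -> dg (u + w) <= k.
Hypothesis dgC : forall c : K, c != 0 -> dg (f c) = 0.
Hypothesis residue : forall u : L, u != 0 -> dg u = 0 ->
  (exists th, u - f th != 0 -> dg (u - f th) < 0) \/
  (forall Q : {poly K}, Q != 0 -> ev1 f u Q != 0 /\ dg (ev1 f u Q) = 0).
Hypothesis D1D : forall u w, D1 (u + w) = D1 u + D1 w.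
Hypothesis D1M : forall u w, D1 (u * w) = D1 u * w + u * D1 w.
Hypothesis D1C : forall c, D1 (f c) = 0.
Hypothesis D2D : forall u w, D2 (u + w) = D2 u + D2 w.
Hypothesis D2M : forall u w, D2 (u * w) = D2 u * w + u * D2 w.
Hypothesis D2C : forall c, D2 (f c) = 0.
Hypothesis dgD1 : forall u, D1 u != 0 -> dg (D1 u) <= dg u - 1.
Hypothesis dgD2 : forall u, D2 u != 0 -> dg (D2 u) <= dg u.

(* Degrees are made variables first, since equal ones may differ in the ring
   structure that they mention. *)
Local Ltac dglia :=
  repeat match goal with |- context [dg ?x] =>
    let n := fresh "n" in move: (dg x) => n end; clear; lia.

Lemma dg_one : dg 1 = 0.
Proof. by rewrite -(rmorph1 f) dgC ?oner_neq0. Qed.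

Lemma dg_inv u : u != 0 -> dg u^-1 = - dg u.
Proof.
move=> u0; apply/eqP; rewrite -addr_eq0 -dgM ?invr_neq0 // mulVf //.
by rewrite dg_one.
Qed.

Lemma dg_exp u (k : nat) : u != 0 -> dg (u ^+ k) = k%:Z * dg u.
Proof.
move=> u0; elim: k => [|k IH]; first by rewrite dg_one mul0r.
rewrite exprS dgM ?expf_neq0 // IH; dglia.
Qed.

Lemma dg_opp u : dg (- u) = dg u.
Proof.
have [->|u0] := eqVneq u 0; first by rewrite oppr0.
rewrite -mulN1r dgM ?oppr_eq0 ?oner_eq0 // -(rmorph1 f) -rmorphN dgC ?add0r //.
by rewrite oppr_eq0 oner_eq0.
Qed.

(** Degree at most k, where 0 has degree minus infinity. *)
Definition dgle u (k : int) : bool := (u == 0) || (dg u <= k).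

Lemma dgleD u w k : dgle u k -> dgle w k -> dgle (u + w) k.
Proof.
rewrite /dgle => hu hw; have [//|s0] := eqVneq (u + w) 0.
apply: dgD => // [u0|w0]; first by move: hu; rewrite (negPf u0).
by move: hw; rewrite (negPf w0).
Qed.

Lemma dgleM u w k l : dgle u k -> dgle w l -> dgle (u * w) (k + l).
Proof.
rewrite /dgle; have [->|u0] := eqVneq u 0; first by rewrite mul0r eqxx.
have [->|w0] := eqVneq w 0; first by rewrite mulr0 eqxx.
by rewrite (negPf (mulf_neq0 u0 w0)) dgM //; apply: lerD.
Qed.

Lemma dgleN u k : dgle (- u) k = dgle u k.
Proof. by rewrite /dgle oppr_eq0 dg_opp. Qed.

Lemma dgle_trans u k l : dgle u k -> k <= l -> dgle u l.
Proof. by rewrite /dgle => /orP[->//|h] kl; rewrite (le_trans h kl) orbT. Qed.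

Lemma dgle_refl u : dgle u (dg u).
Proof. by rewrite /dgle lexx orbT. Qed.

Lemma dgleC c : dgle (f c) 0.
Proof.
have [->|c0] := eqVneq c 0; first by rewrite rmorph0 /dgle eqxx.
by rewrite /dgle dgC // lexx orbT.
Qed.

Lemma dgleM0 u w : dgle u 0 -> dgle w 0 -> dgle (u * w) 0.
Proof. by move=> u0 w0; rewrite -[0]addr0; apply: dgleM. Qed.

Lemma dgD_dominant u w : u != 0 -> dgle w (dg u - 1) ->
  u + w != 0 /\ dg (u + w) = dg u.
Proof.
move=> u0 lew.
have nle : ~~ dgle u (dg u - 1) by rewrite /dgle (negPf u0) /=; lia.
have uw0 : u + w != 0.
  by apply: contra nle; rewrite addr_eq0 => /eqP uE; rewrite {1}uE dgleN.
split => //; have h1 : dgle (u + w) (dg u).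
  by apply: dgleD; [exact: dgle_refl | apply: dgle_trans lew _; lia].
move: h1; rewrite /dgle (negPf uw0) /= => h1.
apply/eqP; rewrite eq_le h1 /= leNgt; apply: contra nle => h2.
rewrite -[X in dgle X _](addrK w); apply: dgleD; last by rewrite dgleN.
by apply: dgle_trans (dgle_refl _) _; move: h2; dglia.
Qed.

Lemma dgle_ev1 b q : dgle b 0 -> dgle (ev1 f b q) 0.
Proof.
move=> b0; elim/poly_ind: q => [|q c IH]; first by rewrite rmorph0 /dgle eqxx.
rewrite rmorphD rmorphM ev1X ev1C; apply: dgleD; last exact: dgleC.
exact: dgleM0.
Qed.

Lemma dgle_ev2 a b P : dgle a 0 -> dgle b 0 -> dgle (ev2 f a b P) 0.
Proof.
move=> a0 b0; elim/poly_ind: P => [|P q IH]; first by rewrite rmorph0 /dgle eqxx.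
rewrite rmorphD rmorphM ev2X ev2C; apply: dgleD; last exact: dgle_ev1.
exact: dgleM0.
Qed.

(** ** Jacobians *)

Definition jac u w := D1 u * D2 w - D2 u * D1 w.

Lemma jacC u w : jac w u = - jac u w.
Proof. by rewrite /jac; ring. Qed.

Lemma jac_mul u w : jac u (u * w) = u * jac u w.
Proof. by rewrite /jac D1M D2M; ring. Qed.

Lemma jac_addC u w c : jac u (w + f c) = jac u w.
Proof. by rewrite /jac D1D D2D D1C D2C !addr0. Qed.

Lemma jac0 u : jac u 0 = 0.
Proof.
have D10 : D1 0 = 0 by rewrite -[in LHS](rmorph0 f) D1C.
have D20 : D2 0 = 0 by rewrite -[in LHS](rmorph0 f) D2C.
by rewrite /jac D10 D20 !mulr0 subrr.
Qed.

Lemma jac_neq0 u w : jac u w != 0 -> (u != 0) && (w != 0).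
Proof.
move=> j; apply/andP; split; apply: contraNneq j => ->; last by rewrite jac0.
by rewrite jacC jac0 oppr0.
Qed.

Lemma dg_jac u w : jac u w != 0 -> dg (jac u w) <= dg u + dg w - 1.
Proof.
have h1 v : dgle (D1 v) (dg v - 1).
  by rewrite /dgle; have [//|/dgD1] := eqVneq (D1 v) 0.
have h2 v : dgle (D2 v) (dg v).
  by rewrite /dgle; have [//|/dgD2] := eqVneq (D2 v) 0.
move=> j0; have : dgle (jac u w) (dg u + dg w - 1).
  apply: dgleD; rewrite ?dgleN.
    by apply: dgle_trans (dgleM (h1 u) (h2 w)) _; dglia.
  by apply: dgle_trans (dgleM (h2 u) (h1 w)) _; dglia.
by rewrite /dgle (negPf j0).
Qed.

(** ** Multiplicities at infinitely near points *)

Lemma ev2_swap a b P : ev2 f a b (swapXY P) = ev2 f b a P.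
Proof.
apply: (bipoly_rmorph_eq (f := (ev2 f a b \o swapXY)%FUN) (g := ev2 f b a)) => [c||] /=.
- by rewrite swapXY_polyC map_polyC !ev2C !ev1C.
- by rewrite swapXY_Y ev2X ev2C ev1X.
by rewrite swapXY_X ev2X ev2C ev1X.
Qed.

(** The point at infinity where a and b vanish is blown up repeatedly. If b / a has
    a residue th in K, write b = a * (th + b'). The pull-back of P is a ^ s times a
    strict transform of multiplicity at most s at the new point, and
    jac a b = a * jac a b'. So, from the bound for multiplicity s at the new point to
    the one at the old point, both sides grow by s * (- dg a). This must stop:
    - dg (jac a b) decreases, but by [dg_jac] it exceeds - dg a - dg b. It stops when
    the residue of b / a is transcendental over K, and then the strict transform has
    degree 0. *)
Lemma dg_ev2_ge a b P (i j r : nat) : jac a b != 0 -> dg a < 0 -> dg b < 0 ->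
  P`_i`_j != 0 -> (i + j <= r)%N ->
  ev2 f a b P != 0 /\ - dg (ev2 f a b P) <= r%:Z * (- dg (jac a b) - 2).
Proof.
have [n] := ubnP (`|- dg (jac a b)|)%N.
elim: n => // n IH in a b P i j r *.
wlog ba : a b P i j / dg b <= dg a.
  move=> W; case: (leP (dg b) (dg a)) => [ba|ab]; first exact: W.
  move=> ltn j0 a0 b0 Pij ijr; have := W b a (swapXY P) j i (ltW ab).
  by rewrite jacC dg_opp oppr_eq0 coef_swapXY ev2_swap addnC; apply.
move=> ltn j0 a0 b0 Pij ijr.
have /andP[an0 bn0] := jac_neq0 j0.
have dgj := dg_jac j0.
have [s [P1 [sij P10 sP1 evP]]] := strict_transform Pij.
pose be := b / a; have bE : b = a * be by rewrite mulrC divfK.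
have be0 : be != 0 by rewrite mulf_neq0 ?invr_eq0.
have dgbe : dg be = dg b - dg a by rewrite dgM ?invr_eq0 // dg_inv.
have jE : jac a b = a * jac a be by rewrite bE jac_mul.
have an0s : a ^+ s != 0 by rewrite expf_neq0.
have sr : (s <= r)%N := leq_trans sij ijr.
rewrite [in ev2 _ _ _ _]bE evP.
have [[th dgth]|dgQ] : (exists th, be - f th != 0 -> dg (be - f th) < 0) \/
    (dg be = 0 /\ forall Q : {poly K}, Q != 0 -> ev1 f be Q != 0 /\ dg (ev1 f be Q) = 0).
  have [lt|ge] := ltP (dg be) 0.
    by left; exists 0; rewrite rmorph0 subr0.
  have e0 : dg be = 0 by apply/eqP; rewrite eq_le ge andbT dgbe; move: ba; dglia.
  by have [] := residue be0 e0; [left|right].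
- set b' := be - f th in dgth.
  have jb' : jac a b' = jac a be by rewrite /b' -rmorphN jac_addC.
  have j0' : jac a b' != 0 by move: j0; rewrite jE jb' mulf_eq0 negb_or => /andP[].
  have /andP[_ b'0] := jac_neq0 j0'.
  have dgjE : dg (jac a b) = dg a + dg (jac a b') by rewrite jE -jb' dgM.
  have dgj' := dg_jac j0'.
  have sz2 : (1 < size ('X + th%:P)%R)%N by rewrite size_XaddC.
  have P2E : ev2 f a be P1 = ev2 f a b' (shift th P1).
    by rewrite ev2_shift subrK.
  set q := (shift th P1)`_0.
  have q0 : q != 0 by rewrite /q coef_shift comp_poly_eq0.
  have sq : (size q <= s.+1)%N.
    by rewrite /q coef_shift size_comp_poly2 ?size_XaddC.
  have [] := IH a b' (shift th P1) 0%N (size q).-1 s => //.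
  - by move: ltn dgj' a0 (dgth b'0); rewrite dgjE; dglia.
  - exact: dgth.
  - by rewrite -/q -lead_coefE lead_coef_eq0.
  - by rewrite add0n -ltnS prednK // size_poly_gt0.
  rewrite -P2E => ev0 dgev; split; first by rewrite mulf_neq0.
  rewrite dgM // dg_exp // dgjE.
  have db' := dgth b'0.
  have : s%:Z * (- dg (jac a b') - dg a - 2) <= r%:Z * (- dg (jac a b') - dg a - 2).
    by apply: ler_wpM2r => //; move: dgj' a0 (dgth b'0); dglia.
  by move: dgev; dglia.
have {dgQ} [e0 dgQ] := dgQ.
have [q0 dgq] := dgQ _ P10.
(* on the exceptional divisor a = 0 the strict transform does not vanish *)
have evE : ev2 f a be P1 = ev1 f be P1`_0 + a * ev2 f a be (drop_poly 1 P1).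
  have P1E : P1 = (P1`_0)%:P + drop_poly 1 P1 * 'X.
    apply/polyP => -[|k]; rewrite coefD coefC coefMX ?addr0 //=.
    by rewrite coef_drop_poly addn1 add0r.
  by rewrite {1}P1E rmorphD rmorphM /= ev2X ev2C [a * _]mulrC.
have [ev0 dgev] : ev2 f a be P1 != 0 /\ dg (ev2 f a be P1) = 0.
  rewrite evE -dgq; apply: dgD_dominant; rewrite // dgq.
  rewrite -[0 - 1]addr0; apply: dgleM.
    by rewrite /dgle; apply/orP; right; move: a0; dglia.
  by apply: dgle_ev2; rewrite /dgle ?e0 ?lexx ?(ltW a0) ?orbT.
split; first by rewrite mulf_neq0.
rewrite dgM // dg_exp // dgev.
have : s%:Z * (- dg a) <= r%:Z * (- dg (jac a b) - 2).
  by apply: ler_pM => //; move: dgj a0 b0; dglia.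
by dglia.
Qed.

(** ** The toric chart at infinity *)

Definition dlog (D : L -> L) u := D u / u.

Lemma dlogM D u w : (forall x y, D (x * y) = D x * y + x * D y) ->
  u != 0 -> w != 0 -> dlog D (u * w) = dlog D u + dlog D w.
Proof. by move=> DM u0 w0; rewrite /dlog DM; field; rewrite u0 w0. Qed.

Lemma dlogV D u : (forall x y, D (x * y) = D x * y + x * D y) ->
  u != 0 -> dlog D u^-1 = - dlog D u.
Proof.
move=> DM u0; apply/eqP; rewrite -addr_eq0 -dlogM ?invr_neq0 // mulVf //.
have := DM 1 1; rewrite /dlog !mul1r mulr1 => /eqP.
by rewrite -subr_eq0 opprD addNKr oppr_eq0 => /eqP->; rewrite mul0r.
Qed.

Lemma dlogX D u (k : nat) : (forall x y, D (x * y) = D x * y + x * D y) ->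
  u != 0 -> dlog D (u ^+ k) = k%:R * dlog D u.
Proof.
move=> DM u0; elim: k => [|k IH].
  have := DM 1 1; rewrite /dlog !mul1r mulr1 => /eqP.
  by rewrite -subr_eq0 opprD addNKr oppr_eq0 => /eqP->; rewrite !mul0r.
by rewrite exprS dlogM ?expf_neq0 // IH mulrSr; ring.
Qed.

Lemma jac_dlog u w : u != 0 -> w != 0 ->
  jac u w = u * w * (dlog D1 u * dlog D2 w - dlog D2 u * dlog D1 w).
Proof. by move=> u0 w0; rewrite /jac /dlog; field; rewrite u0 w0. Qed.

(** The exponents of a and t form a unimodular matrix, so that the logarithmic
    2-forms of (a, t) and of (u, w) coincide. *)
Lemma jac_monomials u w (i j m n : nat) : u != 0 -> w != 0 -> (j * n = (i * m).+1)%N ->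
  let a := u ^+ i / w ^+ j in let t := u ^+ n / w ^+ m in
  jac a t = a * t / (u * w) * jac u w.
Proof.
move=> u0 w0 bez a t.
have ui := expf_neq0 i u0; have un := expf_neq0 n u0.
have wj := expf_neq0 j w0; have wm := expf_neq0 m w0.
have a0 : a != 0 by rewrite mulf_neq0 ?invr_eq0.
have t0 : t != 0 by rewrite mulf_neq0 ?invr_eq0.
rewrite !jac_dlog // /a /t !dlogM ?invr_eq0 // !dlogV // !dlogX // -/a -/t.
have e : j%:R * n%:R = i%:R * m%:R + 1 :> L by rewrite -!natrM bez -natr1.
set l1 := dlog D1 u; set l2 := dlog D2 u; set r1 := dlog D1 w; set r2 := dlog D2 w.
transitivity (a * t * ((j%:R * n%:R - i%:R * m%:R) * (l1 * r2 - l2 * r1))).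
  by ring.
by rewrite e addrAC subrr add0r mul1r; field; rewrite u0 w0.
Qed.

Definition mev u w : {mpoly K[2]} -> L :=
  mmap f (fun i : 'I_2 => if i == 0 then u else w).

Lemma mevE u w p :
  mev u w p = \sum_(m <- msupp p) f p@_m * (u ^+ m 0 * w ^+ m 1).
Proof.
apply: eq_bigr => m _; rewrite /mmap1 !big_ord_recl big_ord0 mulr1 /=.
by rewrite lift01.
Qed.

Definition wt (m n : nat) (mu : 'X_{1..2}) : nat := (m * mu 0%R + n * mu 1%R)%N.

Definition has_wdeg (m n : nat) (p : {mpoly K[2]}) (N : nat) : Prop :=
  (exists2 mu, mu \in msupp p & wt m n mu = N) /\
  (forall mu, mu \in msupp p -> (wt m n mu <= N)%N).

(** Here d is the gcd of the degrees of u and w. In the toric chart with coordinates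
    a and t, the line a = 0 is at infinity and t is a unit on it. *)
Section Toric.
Variables (u w : L) (d m n i j : nat).
Hypothesis juw : jac u w != 0.
Hypothesis juw_ge0 : 0 <= dg (jac u w).
Hypotheses (dgu : dg u = (d * m)%N%:Z) (dgw : dg w = (d * n)%N%:Z).
Hypotheses (d_gt0 : (0 < d)%N) (m_gt0 : (0 < m)%N) (n_gt0 : (0 < n)%N).
Hypothesis bezout : (j * n = (i * m).+1)%N.

Let a := u ^+ i / w ^+ j.
Let t := u ^+ n / w ^+ m.

Let uw0 : (u != 0) && (w != 0) := jac_neq0 juw.
Let u0 : u != 0 := proj1 (andP uw0).
Let w0 : w != 0 := proj2 (andP uw0).
Let a0 : a != 0.
Proof. by rewrite mulf_neq0 ?invr_eq0 ?expf_neq0. Qed.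
Let t0 : t != 0.
Proof. by rewrite mulf_neq0 ?invr_eq0 ?expf_neq0. Qed.

Lemma dg_toric_a : dg a = - d%:Z.
Proof.
rewrite /a dgM ?invr_eq0 ?expf_neq0 // dg_inv ?expf_neq0 // !dg_exp // dgu dgw.
have : (j * (d * n) = d + i * (d * m))%N.
  by rewrite mulnCA bezout -addn1 mulnDr muln1 addnC mulnCA.
by lia.
Qed.

Lemma dg_toric_t : dg t = 0.
Proof.
rewrite /t dgM ?invr_eq0 ?expf_neq0 // dg_inv ?expf_neq0 // !dg_exp // dgu dgw.
by lia.
Qed.

Let texp (mu : 'X_{1..2}) : nat := (j * mu 0%R + i * mu 1%R)%N.

Let texp_l mu : (n * texp mu = mu 0%R + i * wt m n mu)%N.
Proof. by rewrite /texp /wt; nia. Qed.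

Let texp_r mu : (m * texp mu + mu 1%R = j * wt m n mu)%N.
Proof. by rewrite /texp /wt; nia. Qed.

Lemma toric_monomial mu : t ^+ texp mu = a ^+ wt m n mu * (u ^+ mu 0%R * w ^+ mu 1%R).
Proof.
have wj := expf_neq0 j w0; have wm := expf_neq0 m w0.
have ta : t ^+ j = a ^+ m * u.
  rewrite /t /a !exprMn !exprVn -!exprM [(n * j)%N]mulnC bezout exprSr.
  by rewrite [(j * m)%N]mulnC mulrAC.
have tb : t ^+ i = a ^+ n * w.
  rewrite /t /a !exprMn !exprVn -!exprM bezout exprSr [(n * i)%N]mulnC.
  rewrite [(m * i)%N]mulnC invfM mulrA -!mulrA mulVf ?mulr1 //.
by rewrite /texp /wt !exprD !exprM ta tb !exprMn; ring.
Qed.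

Section Pullback.
Variables (p : {mpoly K[2]}) (N : nat).
Hypothesis pN : has_wdeg m n p N.

(* p (u, w) pulled back to the chart, without its pole a ^ (- N) *)
Let Q : {poly {poly K}} :=
  \sum_(mu <- msupp p) (p@_mu *: 'X^(texp mu))%:P * 'X^(N - wt m n mu).

Lemma ev2_toric : ev2 f a t Q = a ^+ N * mev u w p.
Proof.
rewrite mevE mulr_sumr rmorph_sum big_seq [RHS]big_seq; apply: eq_bigr => mu mup.
rewrite rmorphM rmorphXn ev2C ev2X -mul_polyC rmorphM rmorphXn ev1C ev1X.
rewrite toric_monomial; have [_ /(_ mu mup) le] := pN.
have -> : a ^+ N = a ^+ (N - wt m n mu) * a ^+ wt m n mu by rewrite -exprD subnK.
by ring.
Qed.

Lemma coef_toric E : Q`_0`_E =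
  \sum_(mu <- msupp p | (wt m n mu == N) && (texp mu == E)) p@_mu.
Proof.
rewrite /Q !coef_sum [RHS]big_mkcond big_seq [RHS]big_seq.
apply: eq_bigr => mu mup; have [_ /(_ mu mup) le] := pN.
rewrite coefCM coefXn [0%N == _]eq_sym subn_eq0.
have -> : (N <= wt m n mu)%N = (wt m n mu == N) by rewrite eqn_leq le.
case: eqP => _ /=; last by rewrite mulr0 coef0.
by rewrite mulr1 coefZ coefXn eq_sym; case: eqP; rewrite ?mulr1 ?mulr0.
Qed.

Lemma toric_neq0 : Q`_0 != 0.
Proof.
have [[mu mup muN] _] := pN.
suff : Q`_0`_(texp mu) != 0 by apply: contraNneq => ->; rewrite coef0.
rewrite coef_toric big_mkcond (bigD1_seq mu) ?msupp_uniq //= muN !eqxx.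
rewrite big1 ?addr0 -?mcoeff_msupp // => nu ne.
case: ifP => // /andP[/eqP nuN /eqP te].
case/eqP: ne; apply/mnmP => k.
have l0 : nu 0%R = mu 0%R.
  by have := texp_l mu; have := texp_l nu; rewrite te nuN muN; lia.
have l1 : nu 1%R = mu 1%R.
  by have := texp_r mu; have := texp_r nu; rewrite te nuN muN; lia.
by case: k => [[|[|k]] hk] //; [move: l0|move: l1]; congr (nu _ = mu _); apply: val_inj.
Qed.

(** The leading part of p is a monomial times a polynomial in t, and the exponents
    of t range over an interval of length N / (m * n). *)
Lemma toric_support E : Q`_0`_E != 0 -> (i * N <= n * E)%N && (m * E <= j * N)%N.
Proof.
rewrite coef_toric; have [/hasP[mu _ /andP[/eqP <- /eqP <-]] _|/hasPn none] :=
    boolP (has (fun mu => (wt m n mu == N) && (texp mu == E)) (msupp p)).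
  by rewrite texp_l leq_addl -texp_r leq_addr.
rewrite big1_seq ?eqxx // => mu /andP[h mup].
by move: (none mu mup); rewrite h.
Qed.

Let aN0 : a ^+ N != 0.
Proof. by rewrite expf_neq0. Qed.

Lemma mev_toric b : ev2 f a t Q = b -> b != 0 ->
  mev u w p != 0 /\ dg (mev u w p) = (N * d)%N%:Z + dg b.
Proof.
rewrite ev2_toric => <-; rewrite mulf_eq0 negb_or => /andP[_ p0]; split => //.
rewrite dgM // dg_exp // dg_toric_a; dglia.
Qed.

Lemma dg_mev_transcendental :
  (forall q : {poly K}, q != 0 -> ev1 f t q != 0 /\ dg (ev1 f t q) = 0) ->
  mev u w p != 0 /\ dg (mev u w p) = (N * d)%N%:Z.
Proof.
move=> /(_ _ toric_neq0)[q0 dgq].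
have QE : Q = (Q`_0)%:P + drop_poly 1 Q * 'X.
  apply/polyP => -[|k]; rewrite coefD coefC coefMX ?addr0 //=.
  by rewrite coef_drop_poly addn1 add0r.
have evE : ev2 f a t Q = ev1 f t Q`_0 + a * ev2 f a t (drop_poly 1 Q).
  by rewrite {1}QE rmorphD rmorphM /= ev2X ev2C [a * _]mulrC.
have [s0 dgs] : ev1 f t Q`_0 + a * ev2 f a t (drop_poly 1 Q) != 0 /\
   dg (ev1 f t Q`_0 + a * ev2 f a t (drop_poly 1 Q)) = dg (ev1 f t Q`_0).
  apply: dgD_dominant => //; rewrite dgq addrC; apply: dgleM.
    by rewrite /dgle dg_toric_a lerN2 lez_nat d_gt0 orbT.
  apply: dgle_ev2; rewrite /dgle ?dg_toric_a ?dg_toric_t ?lexx ?orbT //.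
  by rewrite oppr_le0 lez_nat orbT.
by have [p0 ->] := mev_toric evE s0; rewrite dgs dgq addr0.
Qed.

(** The multiplicity r of the root th of the leading part of p is at most the length
    N / (m * n) of its support; [dg_ev2_ge] then applies at the point a = 0, t = th. *)
Lemma dg_mev_ge th : (t - f th != 0 -> dg (t - f th) < 0) ->
  mev u w p != 0 /\ exists2 r, (r * (m * n) <= N)%N &
   (N * d)%N%:Z <= dg (mev u w p) + r%:Z * (d%:Z + (d * m)%N%:Z + (d * n)%N%:Z - 2).
Proof.
move=> dgW; set W := t - f th in dgW.
have th0 : th != 0.
  apply: contraTneq t0 => thE; apply/negP => t_0; move: dgW.
  by rewrite /W thE rmorph0 subr0 dg_toric_t ltxx => /(_ t_0).
have jaW : jac a W = a * t / (u * w) * jac u w.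
  by rewrite /W -rmorphN jac_addC; apply: jac_monomials.
have c0 : a * t / (u * w) != 0.
  by apply: mulf_neq0; [apply: mulf_neq0 | rewrite invr_eq0; apply: mulf_neq0].
have jaW0 : jac a W != 0 by rewrite jaW mulf_neq0.
have W0 : W != 0 by have /andP[] := jac_neq0 jaW0.
have dgj : dg (jac a W) = dg (jac u w) - d%:Z - (d * m)%N%:Z - (d * n)%N%:Z.
  have at0 : a * t != 0 by apply: mulf_neq0.
  have uwn0 : u * w != 0 by apply: mulf_neq0.
  have uwV0 : (u * w)^-1 != 0 by rewrite invr_eq0.
  rewrite jaW (dgM c0 juw) (dgM at0 uwV0) (dg_inv uwn0) (dgM a0 t0) (dgM u0 w0).
  rewrite dg_toric_a dg_toric_t dgu dgw; dglia.
have [e [v [r [qe qev rv qr]]]] := shift_lowest toric_neq0 th0.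
have da : dg a < 0 by rewrite dg_toric_a oppr_lt0 ltz_nat.
have := dg_ev2_ge (P := shift th Q) (i := 0) (j := r) (r := r) jaW0 da (dgW W0).
rewrite coef_shift add0n leqnn qr => /(_ isT isT); rewrite ev2_shift {1}/W subrK.
move=> [ev0 dgev]; have [p0 ->] := mev_toric (erefl _) ev0; split => //.
have /andP[_ le1] := toric_support qev; have /andP[le2 _] := toric_support qe.
exists r.
  have : (v * (m * n) <= N)%N.
    have := leq_mul (leqnn n) le1; have := leq_mul (leqnn m) le2.
    have -> : (n * (j * N) = m * (i * N) + N)%N.
      by rewrite mulnA [(n * j)%N]mulnC bezout mulSn addnC [(i * m)%N]mulnC mulnA.
    have -> : (n * (m * (e + v)) = m * (n * e) + v * (m * n))%N.
      by rewrite mulnCA !mulnDr; congr addn; rewrite mulnA mulnC.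
    move=> h1 h2; rewrite -(leq_add2l (m * (n * e))).
    by apply: leq_trans h2 _; rewrite leq_add2r.
  by apply: leq_trans; rewrite leq_mul2r rv orbT.
have : r%:Z * (- dg (jac a W) - 2) <=
       r%:Z * (d%:Z + (d * m)%N%:Z + (d * n)%N%:Z - 2).
  by apply: ler_wpM2l => //; rewrite dgj; move: juw_ge0; dglia.
by move: dgev; dglia.
Qed.

End Pullback.
End Toric.

Lemma wdeg_exists (m n : nat) (p : {mpoly K[2]}) : p != 0 -> exists N, has_wdeg m n p N.
Proof.
rewrite -msupp_eq0 /has_wdeg => sp.
suff [mu mup mumax] : exists2 mu, mu \in msupp p &
    forall nu, nu \in msupp p -> (wt m n nu <= wt m n mu)%N.
  by exists (wt m n mu); split => //; exists mu.
elim: (msupp p) sp => // mu s IH _; have [->|sn] := eqVneq s [::].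
  by exists mu; rewrite ?mem_seq1 // => nu; rewrite mem_seq1 => /eqP->.
have [nu nus numax] := IH sn; have [le|/ltnW le] := leqP (wt m n nu) (wt m n mu).
  exists mu; rewrite ?mem_head // => la; rewrite inE => /orP[/eqP->//|las].
  exact: leq_trans (numax _ las) le.
exists nu; rewrite ?inE ?nus ?orbT // => la; rewrite inE => /orP[/eqP->//|las].
exact: numax.
Qed.

(** The chain rule without partial derivatives of p: the elements with this property
    form a subring that contains K, u and w. *)
Lemma dif_mev u w p : exists c1 c2 : L, forall D : L -> L,
  (D = D1 \/ D = D2) -> D (mev u w p) = c1 * D u + c2 * D w.
Proof.
pose S v := exists c1 c2 : L, forall D : L -> L, (D = D1 \/ D = D2) -> D v = c1 * D u + c2 * D w.
have SC c : S (f c).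
  by exists 0, 0 => D [->|->]; rewrite ?D1C ?D2C !mul0r addr0.
have SM x y : S x -> S y -> S (x * y).
  move=> [a1 [a2 Ha]] [b1 [b2 Hb]].
  exists (a1 * y + x * b1), (a2 * y + x * b2) => D hD.
  have -> : D (x * y) = D x * y + x * D y by case: hD => ->.
  by rewrite (Ha D hD) (Hb D hD); ring.
have SD x y : S x -> S y -> S (x + y).
  move=> [a1 [a2 Ha]] [b1 [b2 Hb]].
  exists (a1 + b1), (a2 + b2) => D hD.
  have -> : D (x + y) = D x + D y by case: hD => ->.
  by rewrite (Ha D hD) (Hb D hD); ring.
have SX x (k : nat) : S x -> S (x ^+ k).
  move=> Sx; elim: k => [|k IH]; first by rewrite expr0 -(rmorph1 f); apply: SC.
  by rewrite exprS; apply: SM.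
have Su : S u by exists 1, 0 => D _; ring.
have Sw : S w by exists 0, 1 => D _; ring.
rewrite -/(S _) mevE; apply: (big_ind S) => //; first by rewrite -(rmorph0 f).
by move=> mu _; apply: (SM _ _ (SC _)); apply: SM; apply: SX.
Qed.

Lemma jac_mev u w (p q : {mpoly K[2]}) : jac (mev u w p) (mev u w q) != 0 -> jac u w != 0.
Proof.
have [a1 [a2 Ha]] := dif_mev u w p; have [b1 [b2 Hb]] := dif_mev u w q.
have E1 := Ha D1 (or_introl erefl); have E2 := Ha D2 (or_intror erefl).
have F1 := Hb D1 (or_introl erefl); have F2 := Hb D2 (or_intror erefl).
have -> : jac (mev u w p) (mev u w q) = (a1 * b2 - a2 * b1) * jac u w.
  by rewrite /jac E1 E2 F1 F2; ring.
by rewrite mulf_eq0 negb_or => /andP[].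
Qed.

Lemma mev_neq0 u w p : mev u w p != 0 -> p != 0.
Proof. by apply: contraNneq => ->; rewrite /mev mmap0. Qed.

(** Two such polynomials have Jacobian 0, which in [leading_power] excludes all
    weights but m = n = 1 when nothing cancels. *)
Lemma mev_affine u w (m n : nat) (p : {mpoly K[2]}) (i : 'I_2) :
  (0 < m)%N -> (0 < n)%N -> (1 < if i == 0%R then n else m)%N -> has_wdeg m n p 1 ->
  exists c c', mev u w p = f c + f c' * (if i == 0 then u else w).
Proof.
move=> m0 n0 lt [_ wp]; set z := if _ then _ else _.
pose S v := exists c c', v = f c + f c' * z.
have S0 : S 0 by exists 0, 0; rewrite rmorph0 mul0r addr0.
have SD x y : S x -> S y -> S (x + y).
  move=> [a [a' ->]] [b [b' ->]]; exists (a + b), (a' + b').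
  by rewrite !rmorphD; ring.
rewrite mevE -/(S _) big_seq; apply: (big_ind S) => // mu /wp; rewrite /wt => le.
have [i0|i0] := eqVneq i 0.
  have zE : z = u by rewrite /z i0 eqxx.
  move: lt; rewrite i0 eqxx => lt.
  have m1 : mu 1 = 0%N by nia.
  have [m00|m01] : mu 0 = 0%N \/ mu 0 = 1%N by nia.
    by exists p@_mu, 0; rewrite m1 m00 rmorph0 mul0r addr0 !expr0 !mulr1.
  by exists 0, p@_mu; rewrite m1 m01 rmorph0 add0r expr0 expr1 mulr1 zE.
have zE : z = w by rewrite /z (negPf i0).
move: lt; rewrite (negPf i0) => lt.
have m1 : mu 0 = 0%N by nia.
have [m00|m01] : mu 1 = 0%N \/ mu 1 = 1%N by nia.
  by exists p@_mu, 0; rewrite m1 m00 rmorph0 mul0r addr0 !expr0 !mulr1.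
by exists 0, p@_mu; rewrite m1 m01 rmorph0 add0r expr0 expr1 mul1r zE.
Qed.

Lemma mev_const u w (p : {mpoly K[2]}) :
  (forall mu, mu \in msupp p -> mu 0%R = 0%N /\ mu 1%R = 0%N) ->
  exists c, mev u w p = f c.
Proof.
move=> h; exists (\sum_(mu <- msupp p) p@_mu).
rewrite mevE rmorph_sum big_seq [RHS]big_seq; apply: eq_bigr => mu /h[-> ->].
by rewrite !expr0 !mulr1.
Qed.

(** Let dg u = d * m and dg w = d * n with m and n coprime. If the residue of
    u ^ n / w ^ m is transcendental over K, the degree of a polynomial in u and w is
    its weighted degree, and x and y, of degree 1, would be functions of u alone or of
    w alone unless both u and w have degree 1.
    Otherwise [dg_mev_ge] applies to x, whose degree is 1. If m and n were at least 2,
    then m + n + 1 <= m * n, which forces r = 0, and x would be a constant. So m or n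
    is 1, and the residue gives the multiple of a power to subtract. *)
Lemma leading_power u w (p q : {mpoly K[2]}) (M N : nat) :
  let x := mev u w p in let y := mev u w q in
  jac x y != 0 -> dg x = 1 -> dg y = 1 -> 0 <= dg (jac u w) ->
  (0 < M)%N -> (0 < N)%N -> dg u = M%:Z -> dg w = N%:Z ->
  [\/ M = 1%N /\ N = 1%N,
     exists c e, N = (e * M)%N /\ (w - f c * u ^+ e != 0 -> dg (w - f c * u ^+ e) < N%:Z)
   | exists c e, M = (e * N)%N /\ (u - f c * w ^+ e != 0 -> dg (u - f c * w ^+ e) < M%:Z)].
Proof.
move=> x y jxy dgx dgy jge M0 N0 dgu dgw.
have juw : jac u w != 0 := jac_mev jxy.
have /andP[u0 w0] := jac_neq0 juw; have /andP[x0 y0] := jac_neq0 jxy.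
set d := gcdn M N; have d0 : (0 < d)%N by rewrite gcdn_gt0 M0.
have [m ME] : exists m, M = (d * m)%N.
  by exists (M %/ d)%N; rewrite mulnC divnK // dvdn_gcdl.
have [n NE] : exists n, N = (d * n)%N.
  by exists (N %/ d)%N; rewrite mulnC divnK // dvdn_gcdr.
have m0 : (0 < m)%N by move: M0; rewrite ME muln_gt0 => /andP[].
have n0 : (0 < n)%N by move: N0; rewrite NE muln_gt0 => /andP[].
have cop : gcdn n m = 1%N.
  by apply/eqP; rewrite -(eqn_pmul2l d0) muln_gcdr -ME -NE gcdnC muln1.
have [j [i bez]] : exists j i, (j * n = (i * m).+1)%N.
  case: (egcdnP m n0) => j i bez _; exists j, i.
  by rewrite bez cop addn1.
pose t := u ^+ n / w ^+ m.
have un := expf_neq0 n u0; have wm := expf_neq0 m w0.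
have t0 : t != 0 by rewrite mulf_neq0 ?invr_eq0.
rewrite ME in dgu; rewrite NE in dgw.
have dgt : dg t = 0 := dg_toric_t juw jge dgu dgw d0 m0 n0 bez.
have [Np wp] := wdeg_exists m n (mev_neq0 x0).
have [Nq wq] := wdeg_exists m n (mev_neq0 y0).
have [[th dgth]|tr] := residue t0 dgt; last first.
  have [_] := dg_mev_transcendental juw jge dgu dgw d0 m0 n0 bez wp tr.
  have [_] := dg_mev_transcendental juw jge dgu dgw d0 m0 n0 bez wq tr.
  rewrite -/x -/y dgx dgy => /esym [/eqP]; rewrite muln_eq1 => /andP[/eqP Nq1 /eqP d1].
  move=> /esym [/eqP]; rewrite muln_eq1 => /andP[/eqP Np1 _].
  rewrite Np1 in wp; rewrite Nq1 in wq.
  suff [m1 n1] : m = 1%N /\ n = 1%N by constructor 1; rewrite ME NE d1 m1 n1.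
  (* otherwise x and y would both be affine in u, or both affine in w *)
  have line (i0 : 'I_2) : ~~ (1 < if i0 == 0%R then n else m)%N.
    apply: contraNN jxy => lt; apply/eqP; rewrite /x /y.
    have [a [a' ->]] := mev_affine u w m0 n0 lt wp.
    have [b [b' ->]] := mev_affine u w m0 n0 lt wq.
    rewrite /jac !D1D !D2D !D1M !D2M !D1C !D2C; ring.
  have := line 0; have := line 1; rewrite /= -!leqNgt => m1 n1.
  by split; apply/eqP; rewrite eqn_leq ?m1 ?n1.
have sm : (m <= 1)%N || (n <= 1)%N.
  rewrite -[_ || _]negbK negb_or -!ltnNge; apply/negP => /andP[m2 n2].
  have mn : m <> n by move=> mn; move: cop; rewrite mn gcdnn => n1; move: n2; rewrite n1.
  have [_ [r rN]] := dg_mev_ge juw jge dgu dgw d0 m0 n0 bez wp dgth.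
  rewrite -/x dgx => le.
  (* as m and n are coprime and at least 2, (m - 1) * (n - 1) is at least 2 *)
  have mnd : (m + n + 1 <= m * n)%N by move: m2 n2 mn; clear; nia.
  have {}le : (Np * d + 2 * r <= 1 + r * (d * (m + n + 1)))%N.
    by move: le; rewrite !mulnDr muln1; clear; lia.
  have h1 : (r * (d * (m + n + 1)) <= Np * d)%N.
    apply: leq_trans (_ : r * (d * (m * n)) <= _)%N.
      by rewrite !leq_mul2l mnd !orbT.
    by rewrite mulnCA mulnC leq_mul2r rN orbT.
  have r0 : r = 0%N by move: le h1; clear; lia.
  have Np1 : (Np <= 1)%N.
    rewrite -[1%N](mul1n 1) -(muln1 Np); apply: leq_trans (_ : Np * d <= _)%N.
      by rewrite leq_mul2l d0 orbT.
    by move: le; rewrite r0 mul0n muln0 !addn0.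
  have [_ wpl] := wp; have [c xE] : exists c, x = f c.
    apply: mev_const => mu /wpl; rewrite /wt; move: Np1 m2 n2; clear.
    by move: (mu 0%R) (mu 1%R) => k l; nia.
  move: dgx; rewrite xE dgC //; apply: contraNneq x0 => c0.
  by rewrite xE c0 rmorph0.
have fth0 : f th != 0.
  apply/negP => /eqP th0; move: dgth; rewrite th0 subr0 => /(_ t0).
  by rewrite dgt ltxx.
case/orP: sm => [m1|n1].
- have {}m1 : m = 1%N by apply/eqP; rewrite eqn_leq m1.
  constructor 2; exists th^-1, n; split; first by rewrite NE ME m1 muln1 mulnC.
  have E : w - f th^-1 * u ^+ n = (- (f th)^-1 * w) * (t - f th).
    by rewrite fmorphV /t m1 expr1; field; rewrite w0 fth0.
  rewrite E mulf_eq0 negb_or => /andP[cw0 tt0].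
  rewrite dgM // mulNr dg_opp -fmorphV dgM ?fmorph_eq0 ?invr_eq0 -?(fmorph_eq0 f) //.
  rewrite dgC ?invr_eq0 -?(fmorph_eq0 f) // dgw -NE.
  by move: (dgth tt0); dglia.
have {}n1 : n = 1%N by apply/eqP; rewrite eqn_leq n1.
constructor 3; exists th, m; split; first by rewrite NE ME n1 muln1 mulnC.
have E : u - f th * w ^+ m = w ^+ m * (t - f th).
  by rewrite /t n1 expr1 mulrBr mulrCA mulfV // mulr1 [f th * _]mulrC.
rewrite E mulf_eq0 negb_or => /andP[_ tt0].
rewrite dgM // dg_exp // dgw.
by have := dgth tt0; rewrite ME n1; dglia.
Qed.

End DegreeField.

(** * Leading forms of plane automorphisms *)

Section Plane.
Variable K : fieldType.
Local Notation R := {poly {poly K}}.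
Local Notation L := {fraction R}.
Local Notation MP := {mpoly K[2]}.
Implicit Types (P : MP) (mu nu : 'X_{1..2}).

(** X0 and X1 are sent to t * s and s, so that the total degree becomes the
    degree in the outer variable s. *)
Definition emb : {rmorphism MP -> R} :=
  mmap (@polyCC K) (fun i : 'I_2 => if i == 0 then 'X%:P * 'X else 'X).

Lemma embC c : emb c%:MP = c%:P%:P.
Proof. by rewrite [LHS]mmapC. Qed.

Lemma embX0 : emb 'X_0 = 'X%:P * 'X.
Proof. by rewrite [LHS]mmapX mmap1U. Qed.

Lemma embX1 : emb 'X_1 = 'X.
Proof. by rewrite [LHS]mmapX mmap1U. Qed.

Lemma embE P : emb P =
  \sum_(mu <- msupp P) (P@_mu *: 'X^(mu 0%R))%:P * 'X^(mu 0%R + mu 1%R).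
Proof.
rewrite /emb /mmap /=; apply: eq_bigr => mu _.
rewrite /mmap1 !big_ord_recl big_ord0 mulr1 /=.
rewrite lift01.
by rewrite -mul_polyC polyCM polyC_exp exprMn exprD; ring.
Qed.

Lemma coef_emb P mu : (emb P)`_(mu 0%R + mu 1%R)`_(mu 0%R) = P@_mu.
Proof.
rewrite embE !coef_sum; have [mup|mup] := boolP (mu \in msupp P).
  rewrite (bigD1_seq mu) ?msupp_uniq //= big1 => [|nu ne].
    by rewrite addr0 coefCM coefXn eqxx mulr1 coefZ coefXn eqxx mulr1.
  rewrite coefCM coefXn; case: eqP => e; last by rewrite mulr0 coef0.
  rewrite mulr1 coefZ coefXn; case: eqP => e0; last by rewrite mulr0.
  case/eqP: ne; apply/mnmP => -[[|[|k]] hk] //.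
    by have := esym e0; congr (nu _ = mu _); apply: val_inj.
  have : nu 1%R = mu 1%R by move: e; rewrite e0 => /addnI.
  by congr (nu _ = mu _); apply: val_inj.
rewrite big_seq big1 => [|nu nup]; first by rewrite (memN_msupp_eq0 mup).
rewrite coefCM coefXn; case: eqP => e; last by rewrite mulr0 coef0.
rewrite mulr1 coefZ coefXn; case: eqP => e0; last by rewrite mulr0.
case/negP: mup; suff -> : mu = nu by [].
apply/mnmP => -[[|[|k]] hk] //.
  by have := e0; congr (mu _ = nu _); apply: val_inj.
have : mu 1%R = nu 1%R by move: e; rewrite e0 => /addnI.
by congr (mu _ = nu _); apply: val_inj.
Qed.

Lemma msupp_emb P mu : mu \in msupp P -> (mu 0%R + mu 1%R < size (emb P))%N.
Proof.
rewrite mcoeff_msupp -coef_emb => h; rewrite ltnNge; apply: contra h => le.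
by rewrite [(emb P)`_(_ + _)]nth_default // coef0.
Qed.

Lemma emb_affine P : (size (emb P) <= 2)%N ->
  exists al be ga, P = al *: 'X_0 + be *: 'X_1 + ga%:MP_[2].
Proof.
move=> sP; pose S (Q : MP) := exists al be ga, Q = al *: 'X_0 + be *: 'X_1 + ga%:MP.
have S0 : S 0 by exists 0, 0, 0; rewrite !scale0r mpolyC0 !addr0.
have SD (x y : MP) : S x -> S y -> S (x + y).
  move=> [a [b [c ->]]] [a' [b' [c' ->]]]; exists (a + a'), (b + b'), (c + c').
  by rewrite !scalerDl mpolyCD; ring.
rewrite -/(S P) [P]mpolyE big_seq; apply: (big_ind S) => // mu mup.
have := leq_trans (msupp_emb mup) sP; rewrite ltnS => le.
have eX (i0 : 'I_2) : (forall k, mu k = (i0 == k) :> nat) -> 'X_[mu] = 'X_i0 :> MP.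
  by move=> h; congr 'X_[_]; apply/mnmP => k; rewrite mnm1E h.
have two (Pr : 'I_2 -> Prop) : Pr 0 -> Pr 1 -> forall k, Pr k.
  by move=> P0 P1 [[|[|k]] hk] //; [move: P0|move: P1]; congr Pr; apply: val_inj.
have [m0|[m0|m0]] : (mu 0%R = 0 /\ mu 1%R = 0 \/ mu 0%R = 1 /\ mu 1%R = 0 \/
   mu 0%R = 0 /\ mu 1%R = 1)%N by lia.
- exists 0, 0, P@_mu; rewrite !scale0r !add0r.
  have -> : mu = 0%MM by apply/mnmP; apply: two; rewrite mnm0E; case: m0.
  by rewrite mpolyX0 alg_mpolyC.
- exists P@_mu, 0, 0; rewrite scale0r !addr0 (eX 0) //.
  by apply: two; case: m0 => m00 m01; rewrite ?m00 ?m01.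
exists 0, P@_mu, 0; rewrite scale0r add0r addr0 (eX 1) //.
by apply: two; case: m0 => m00 m01; rewrite ?m00 ?m01.
Qed.

Lemma emb_const P : (size (emb P) <= 1)%N -> exists c, P = c%:MP_[2].
Proof.
move=> sP; exists P@_0%MM; rewrite {1}[P]mpolyE big_seq.
have z mu : mu \in msupp P -> mu = 0%MM.
  move=> /msupp_emb mup; have := leq_trans mup sP; rewrite ltnS leqn0 addn_eq0.
  case/andP=> /eqP m0 /eqP m1; apply/mnmP => -[[|[|k]] hk] //; rewrite mnm0E.
    by rewrite -[RHS]m0; congr (mu _); apply: val_inj.
  by rewrite -[RHS]m1; congr (mu _); apply: val_inj.
have [p0|p0] := boolP (0%MM \in msupp P).
  rewrite -big_seq (bigD1_seq 0%MM) ?msupp_uniq //= big_seq_cond big1 => [|mu].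
    by rewrite addr0 mpolyX0 alg_mpolyC.
  by case/andP => /z ->; rewrite eqxx.
rewrite big1 ?(memN_msupp_eq0 p0) // => mu mup.
by move: (mup); rewrite (z _ mup) (negPf p0).
Qed.

Let ds (A : R) : R := A^`().
Let dt (A : R) : R := map_poly (@deriv K) A.

Let dsD (A B : R) : ds (A + B) = ds A + ds B. Proof. exact: derivD. Qed.
Let dsM (A B : R) : ds (A * B) = ds A * B + A * ds B. Proof. exact: derivM. Qed.
Let dtD (A B : R) : dt (A + B) = dt A + dt B. Proof. exact: raddfD. Qed.
Let dtM (A B : R) : dt (A * B) = dt A * B + A * dt B.
Proof.
apply/polyP => k; rewrite coefD coef_map /= !coefM raddf_sum -big_split /=.
by apply: eq_bigr => i _; rewrite derivM !coef_map.
Qed.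

Let Ds : L -> L := fder ds.
Let Dt : L -> L := fder dt.

Let Ds_cst c : Ds (cst K c) = 0.
Proof. by rewrite /Ds fder_tofrac // /ds derivC tofrac0. Qed.
Let Dt_cst c : Dt (cst K c) = 0.
Proof. by rewrite /Dt fder_tofrac // /dt map_polyC /= derivC polyC0 tofrac0. Qed.

Let dg_Ds (u : L) : Ds u != 0 -> dg (Ds u) <= dg u - 1.
Proof.
move=> D0; apply: dg_fder => // A dA0.
have A0 : A != 0 by apply: contraNneq dA0 => ->; rewrite /ds deriv0.
by have := lt_size_deriv A0; rewrite -/(ds A); lia.
Qed.

Let dg_Dt (u : L) : Dt u != 0 -> dg (Dt u) <= dg u.
Proof.
move=> D0; rewrite -[dg u]addr0; apply: dg_fder => // A dA0.
by rewrite addr0 lez_nat size_poly.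
Qed.

Lemma rmorph_comp (A : comNzRingType) (h : {rmorphism MP -> A}) (F : polymap K 2) P :
  h (P \mPo F) = \sum_(mu <- msupp P)
    h (P@_mu)%:MP * (h (tnth F 0) ^+ mu 0%R * h (tnth F 1) ^+ mu 1%R).
Proof.
rewrite comp_mpolyE rmorph_sum; apply: eq_bigr => mu _.
rewrite -mul_mpolyC rmorphM !big_ord_recl big_ord0 mulr1.
rewrite rmorphM !rmorphXn; congr (_ * (_ * _)).
by rewrite lift01.
Qed.

Lemma mev_comp (F : polymap K 2) P :
  mev (cst K) (emb (tnth F 0))%:F (emb (tnth F 1))%:F P = (emb (P \mPo F))%:F.
Proof.
apply/esym; apply: etrans (rmorph_comp (@FracField.tofrac R \o emb)%FUN F P) _.
rewrite mevE; apply: eq_bigr => mu _; congr (_ * _).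
by rewrite /= embC.
Qed.

(** The inverse of F expresses X0 and X1, which have degree 1 and a nonzero Jacobian,
    as polynomials in the components of F. *)
Lemma leading_power_automorphism (F G : polymap K 2) :
  polymap_comp G F = polymap_id K 2 ->
  let M := (size (emb (tnth F 0))).-1 in let N := (size (emb (tnth F 1))).-1 in
  [/\ (0 < M)%N, (0 < N)%N &
  [\/ M = 1%N /\ N = 1%N,
     exists c e, (size (emb (tnth F 1 - c *: tnth F 0 ^+ e))%R <= N)%N
   | exists c e, (size (emb (tnth F 0 - c *: tnth F 1 ^+ e))%R <= M)%N]].
Proof.
move=> GF M N; set u := (emb (tnth F 0))%:F; set w := (emb (tnth F 1))%:F.
have comp i : tnth G i \mPo F = 'X_i.
  by have := congr1 (fun H => tnth H i) GF; rewrite !tnth_mktuple.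
have e0 : mev (cst K) u w (tnth G 0) = ('X%:P * 'X)%:F.
  by rewrite mev_comp comp embX0.
have e1 : mev (cst K) u w (tnth G 1) = 'X%:F.
  by rewrite mev_comp comp embX1.
have jxy : jac Ds Dt (mev (cst K) u w (tnth G 0)) (mev (cst K) u w (tnth G 1)) != 0.
  have dtX : dt 'X = 0.
    apply/polyP => k; rewrite coef_map coefX coef0.
    by case: eqP; rewrite -?polyC1 -?polyC0 /= derivC.
  have dtY : dt 'X%:P = 1 by rewrite /dt map_polyC /= derivX.
  have dsX : ds 'X = 1 by apply: derivX.
  rewrite e0 e1 /jac /Ds /Dt !fder_tofrac // dsX dtX dtM dtX dtY.
  rewrite tofrac0 mulr0 tofrac1 mulr0 addr0 mul1r mulr1 sub0r oppr_eq0.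
  by rewrite tofrac_eq0 polyX_eq0.
have juw : jac Ds Dt u w != 0.
  have h := @jac_mev K _ (cst K) Ds Dt (fderD dsD dsM) (fderM dsM).
  have {}h := h Ds_cst (fderD dtD dtM) (fderM dtM) Dt_cst.
  exact: h jxy.
have /andP[u0 w0] : (u != 0) && (w != 0).
  exact: (jac_neq0 Ds_cst Dt_cst juw).
have juw_ge0 : 0 <= dg (jac Ds Dt u w).
  move: juw; rewrite /jac /Ds /Dt /u /w !fder_tofrac // -!tofracM -tofracB.
  by rewrite tofrac_eq0; apply: dg_poly_ge0.
have pos i : jac Ds Dt u w != 0 -> (0 < (size (emb (tnth F i))).-1)%N.
  rewrite -subn1 subn_gt0 ltnNge; apply: contraNN => le; apply/eqP.
  have [c Fc] := emb_const le.
  have Dc : Ds (emb (tnth F i))%:F = 0 /\ Dt (emb (tnth F i))%:F = 0.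
    by rewrite Fc embC -[(_ %:P%:P)%:F]/(cst K c) Ds_cst Dt_cst.
  have [iE|iE] : i = 0 \/ i = 1.
    by case: i {le Fc Dc} => -[|[|k]] hk //; [left|right]; apply: val_inj.
  - by move: Dc; rewrite iE /jac -/u => -[-> ->]; rewrite !mul0r subrr.
  by move: Dc; rewrite iE /jac -/w => -[-> ->]; rewrite !mulr0 subrr.
have emb0 i : (emb (tnth F i))%:F != 0 -> emb (tnth F i) != 0.
  by apply: contraNneq => ->; rewrite tofrac0.
have dgu : dg u = M%:Z.
  rewrite /u dg_tofrac /M; first by have := pos 0 juw; slia.
  exact: (emb0 0 u0).
have dgw : dg w = N%:Z.
  rewrite /w dg_tofrac /N; first by have := pos 1 juw; slia.
  exact: (emb0 1 w0).
split; [exact: (pos 0 juw) | exact: (pos 1 juw) |].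
have low (i k : 'I_2) c e (B : nat) :
    ((emb (tnth F i))%:F - cst K c * (emb (tnth F k))%:F ^+ e != 0 ->
     dg ((emb (tnth F i))%:F - cst K c * (emb (tnth F k))%:F ^+ e) < B%:Z) ->
    (size (emb (tnth F i - c *: tnth F k ^+ e))%R <= B)%N.
  have -> : (emb (tnth F i))%:F - cst K c * (emb (tnth F k))%:F ^+ e =
      (emb (tnth F i - c *: tnth F k ^+ e))%:F.
    rewrite -mul_mpolyC rmorphB rmorphM rmorphXn embC.
    by rewrite tofracB tofracM tofracXn.
  rewrite tofrac_eq0; have [->|p0] := eqVneq (emb _) 0; first by rewrite size_poly0.
  by move=> /(_ isT); rewrite dg_tofrac //; slia.
have dgx : dg (mev (cst K) u w (tnth G 0)) = 1.
  rewrite e0 dg_tofrac ?mulf_neq0 ?polyC_eq0 ?polyX_eq0 //.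
  by rewrite size_mul ?polyC_eq0 ?polyX_eq0 // size_polyX size_polyC polyX_eq0.
have dgy : dg (mev (cst K) u w (tnth G 1)) = 1.
  by rewrite e1 dg_tofrac ?polyX_eq0 // size_polyX.
have [h|[c [e [_ h]]]|[c [e [_ h]]]] := leading_power (@dgM _) (@dgD _) (@dg_cst K)
  (@residue_alternative K) (fderD dsD dsM) (fderM dsM) Ds_cst
  (fderD dtD dtM) (fderM dtM) Dt_cst dg_Ds dg_Dt jxy dgx dgy juw_ge0
  (pos 0 juw) (pos 1 juw) dgu dgw.
- by constructor 1.
- by constructor 2; exists c, e; apply: low.
by constructor 3; exists c, e; apply: low.
Qed.

End Plane.

(** * Words in two subgroups *)

Section CyclicWords.
Variable G : groupType.
Variables A B : G -> Prop.
Hypothesis AM : forall x y, A x -> A y -> A (x * y)%g.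
Hypothesis BM : forall x y, B x -> B y -> B (x * y)%g.
Implicit Types (x y h : G) (s r : seq G).

Definition letters s : Prop := forall x, x \in s -> A x \/ B x.
Definition onlyA x : Prop := A x /\ ~ B x.
Definition onlyB x : Prop := B x /\ ~ A x.

Definition opposite x y : Prop := (onlyA x /\ onlyB y) \/ (onlyB x /\ onlyA y).

Fixpoint alternating x s : Prop :=
  if s is y :: r then opposite x y /\ alternating y r else True.

(** In a shortest word that represents a conjugate of x, cyclically consecutive
    letters cannot be multiplied within A or within B, since conjugation by the first
    letter moves it to the end. So the letters alternate, and a rotation makes the
    word begin in B and end in A. *)
Lemma cyclic_reduction x s : letters s -> s != [::] -> x = (\prod_(y <- s) y)%g ->
  (exists h, A (x ^ h)%g \/ B (x ^ h)%g) \/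
  (exists h b r a, [/\ (x ^ h)%g = (\prod_(y <- b :: rcons r a) y)%g, onlyB b,
     onlyA a & alternating b (rcons r a)]).
Proof.
move=> ls s0 xs.
pose good r := letters r /\ exists h, (x ^ h)%g = (\prod_(y <- r) y)%g.
have ex : exists n, `[< (0 < n)%N /\ exists2 r, size r = n & good r >].
  exists (size s); apply/asboolP; split; first by case: (s) s0.
  by exists s => //; split => //; exists 1%g; rewrite conjg1.
case: (ex_minnP ex) => n /asboolP[n0 [w wn gw]] nmin.
have rot1 y r : good (y :: r) -> good (rcons r y).
  move=> [l [h e]]; split.
    by move=> z; rewrite mem_rcons => zr; apply: l.
  exists (h * y)%g; rewrite conjgM e big_cons -cats1 big_cat big_seq1 /conjg.
  by rewrite -mulgA mulKg.
have rotn r r' : good (r ++ r') -> good (r' ++ r).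
  elim: r r' => [|y r IH] r'; first by rewrite cats0.
  by move/rot1; rewrite rcons_cat => /IH; rewrite cat_rcons.
have nomerge y z r : size (y :: z :: r) = n -> good (y :: z :: r) -> opposite y z.
  move=> sz [l [h e]].
  have contr (t : G) : (A t \/ B t) -> t = (y * z)%g -> False.
    move=> lt tE; have : `[< (0 < n.-1)%N /\ exists2 r, size r = n.-1 & good r >].
      apply/asboolP; rewrite -sz; split => //; exists (t :: r) => //; split.
        move=> v; rewrite inE => /orP[/eqP->//|vr].
        by apply: l; rewrite !inE vr !orbT.
      by exists h; rewrite e !big_cons tE mulgA.
    by move/nmin; rewrite -sz /= ltnn.
  have nA : ~ (A y /\ A z).
    by move=> [Ay Az]; apply: (contr (y * z)%g) => //; left; apply: AM.
  have nB : ~ (B y /\ B z).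
    by move=> [By Bz]; apply: (contr (y * z)%g) => //; right; apply: BM.
  have ly : A y \/ B y by apply: l; rewrite inE eqxx.
  have lz : A z \/ B z by apply: l; rewrite !inE eqxx orbT.
  rewrite /opposite /onlyA /onlyB; tauto.
have alt pre y r : size (pre ++ y :: r) = n -> good (pre ++ y :: r) -> alternating y r.
  elim: r pre y => [//|z r IH] pre y sz g; split.
    apply: (nomerge y z (r ++ pre)); last exact: (rotn pre (y :: z :: r)).
    by rewrite -sz /= !size_cat /=; lia.
  by apply: (IH (rcons pre y)); rewrite cat_rcons.
have finish b r a : size (b :: rcons r a) = n -> good (b :: rcons r a) ->
    onlyB b -> onlyA a -> exists h b r a,
     [/\ (x ^ h)%g = (\prod_(y <- b :: rcons r a) y)%g, onlyB b,
     onlyA a & alternating b (rcons r a)].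
  move=> sz g Bb Aa; have [_ [h e]] := g; exists h, b, r, a; split => //.
  exact: (alt [::] b (rcons r a)).
case: w wn gw => [|y [|z r]] wn gw.
- by move: n0; rewrite -wn.
- left; have [l [h e]] := gw; exists h; rewrite e big_seq1.
  by apply: l; rewrite inE.
right; have [[Ay Bz]|[By Az]] := nomerge _ _ _ wn gw.
  have := rotn [:: y] (z :: r) gw; rewrite /= cats1 => g'.
  by apply: (finish z r y) => //; rewrite -wn /= size_rcons.
case: r wn gw => [|v r] wn gw; first by apply: (finish y [::] z).
have gw1 := rotn [:: y] _ gw; rewrite /= cats1 /= in gw1.
have sz1 : size [:: z, v & rcons r y] = n by rewrite -wn /= size_rcons.
have [[_ Bv]|[Bz _]] := nomerge z v (rcons r y) sz1 gw1.
  have gw2 := rotn [:: z] _ gw1; rewrite /= cats1 /= in gw2.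
  by apply: (finish v (rcons r y) z) => //; rewrite -wn /= !size_rcons.
by case: Bz => _ /(_ (proj1 Az)).
Qed.

Variables X Y : G -> Prop.
Hypothesis pingA : forall a g, onlyA a -> g = 1%g \/ Y g -> X (a * g)%g.
Hypothesis pingB : forall b g, onlyB b -> X g -> Y (b * g)%g.

Lemma ping_pong_word b r a g : onlyA a -> g = 1%g \/ Y g ->
  alternating b (rcons r a) ->
  (onlyB b -> Y ((\prod_(y <- b :: rcons r a) y) * g)%g) /\
  (onlyA b -> X ((\prod_(y <- b :: rcons r a) y) * g)%g).
Proof.
move=> Aa Yg; elim: r b => [|y r IH] b /= [op alt]; rewrite big_cons -mulgA.
  rewrite big_seq1; split=> [Bb|Ab]; first by apply: pingB => //; apply: pingA.
  by case: op => -[[_ nB] [Ba nA]]; [case: nA; case: Aa | case: nB; case: Ab].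
have [IHB IHA] := IH y alt; split=> [Bb|Ab].
  by apply: pingB => //; apply: IHA; case: op => -[[h1 h2] h] //; case: h2; case: Bb.
apply: pingA => //; right; apply: IHB.
by case: op => -[[h1 h2] h] //; case: h2; case: Ab.
Qed.

Lemma ping_pong b r a n : onlyB b -> onlyA a -> alternating b (rcons r a) ->
  Y ((\prod_(y <- b :: rcons r a) y) ^+ n.+1)%g.
Proof.
move=> Bb Aa alt; elim: n => [|n IH].
  by rewrite expg1 -[X in Y X]mulg1; apply: (proj1 (ping_pong_word _ _ alt)) => //; left.
by rewrite expgS; apply: (proj1 (ping_pong_word _ _ alt)) => //; right.
Qed.

End CyclicWords.

(** * The plane automorphism group *)

Section Automorphisms.
Variable K : fieldType.
Local Notation MP := {mpoly K[2]}.
Local Notation GA2 := (GA K 2).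
Local Notation emb := (emb K).
Local Notation coord F i := (tnth (GAval F) i).
Implicit Types (F G H : GA2) (P : MP).

Definition inX1 (P : MP) : {rmorphism {poly K} -> MP} :=
  horner_morph (fun c => mulrC P (mpolyC 2 c)).

Lemma inX1X P : inX1 P 'X = P. Proof. exact: horner_morphX. Qed.
Lemma inX1C P c : inX1 P c%:P = c%:MP. Proof. exact: horner_morphC. Qed.

Definition affine F : Prop := forall i, exists al be ga,
  coord F i = al *: 'X_0 + be *: 'X_1 + ga%:MP.

Definition triangular F : Prop := exists a (p : {poly K}) b c,
  coord F 0 = a *: 'X_0 + inX1 'X_1 p /\ coord F 1 = b *: 'X_1 + c%:MP.

Lemma tnthM F G i : coord (F * G)%g i = coord F i \mPo GAval G.
Proof. by rewrite tnth_mktuple. Qed.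

Lemma tnth1 i : coord (1%g : GA2) i = 'X_i.
Proof. by rewrite tnth_mktuple. Qed.

Lemma GA_eq F G : coord F 0 = coord G 0 -> coord F 1 = coord G 1 -> F = G.
Proof.
by move=> e0 e1; apply: val_inj; apply: eq_from_tnth => i; have [->|->] := ord2 i.
Qed.

Lemma comp_affine F al be ga :
  (al *: 'X_0 + be *: 'X_1 + ga%:MP) \mPo GAval F = al *: coord F 0 + be *: coord F 1 + ga%:MP.
Proof. by rewrite !comp_mpolyD !comp_mpolyZ !comp_mpolyXU comp_mpolyC -!tnth_nth. Qed.

Lemma comp_inX1 F P p : inX1 P p \mPo GAval F = inX1 (P \mPo GAval F) p.
Proof.
elim/poly_ind: p => [|p c IH]; first by rewrite !rmorph0.
rewrite [inX1 P _]rmorphD [inX1 P _]rmorphM comp_mpolyD [(_ * _) \mPo _]rmorphM /= IH.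
by rewrite [RHS]rmorphD [in RHS]rmorphM !inX1X !inX1C comp_mpolyC.
Qed.

Lemma affineM F G : affine F -> affine G -> affine (F * G)%g.
Proof.
move=> aF aG i; have [al [be [ga e]]] := aF i; rewrite tnthM e comp_affine.
have [a0 [b0 [c0 ->]]] := aG 0; have [a1 [b1 [c1 ->]]] := aG 1.
exists (al * a0 + be * a1), (al * b0 + be * b1), (al * c0 + be * c1 + ga).
by rewrite -!mul_mpolyC !mpolyCD !mpolyCM; ring.
Qed.

Lemma inX1_comp (p : {poly K}) b c :
  inX1 'X_1 (p \Po (b *: 'X + c%:P)) = inX1 (b *: 'X_1 + c%:MP) p.
Proof.
elim/poly_ind: p => [|p d IH]; first by rewrite comp_poly0 !rmorph0.
rewrite comp_polyD comp_polyM comp_polyX comp_polyC.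
rewrite rmorphD rmorphM rmorphD IH -mul_polyC rmorphM [in RHS]rmorphD [in RHS]rmorphM.
by rewrite !inX1X !inX1C mul_mpolyC.
Qed.

Lemma triangularM F G : triangular F -> triangular G -> triangular (F * G)%g.
Proof.
move=> [a [p [b [c [F0 F1]]]]] [a' [p' [b' [c' [G0 G1]]]]].
exists (a * a'), (a *: p' + (p \Po (b' *: 'X + c'%:P))), (b * b'), (b * c' + c).
rewrite !tnthM F0 F1 !comp_mpolyD !comp_mpolyZ comp_inX1 !comp_mpolyXU comp_mpolyC.
rewrite -!tnth_nth G0 G1; split; last first.
  by rewrite -!mul_mpolyC !mpolyCD !mpolyCM; ring.
have -> : inX1 'X_1 (a *: p' + (p \Po (b' *: 'X + c'%:P))) =
    a%:MP * inX1 'X_1 p' + inX1 (b' *: 'X_1 + c'%:MP) p.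
  by rewrite -inX1_comp -[a *: p']mul_polyC rmorphD rmorphM inX1C.
by rewrite -!mul_mpolyC !mpolyCM; ring.
Qed.

Definition swap_map : polymap K 2 := [tuple 'X_(1 - i)| i < 2].
Definition elem_map (c : K) (e : nat) : polymap K 2 :=
  [tuple if i == 0 then 'X_0 + c *: 'X_1 ^+ e else 'X_1 | i < 2].

Lemma swap_map_subproof : `[< polymap_invertible swap_map >].
Proof.
apply/asboolP; exists swap_map.
suff e : polymap_comp swap_map swap_map = polymap_id K 2 by [].
apply: eq_from_tnth => i; rewrite !tnth_mktuple comp_mpolyXU -tnth_nth.
by rewrite tnth_mktuple subKr.
Qed.

Definition swap : GA2 := MkGA swap_map_subproof.

Lemma elem_map_comp c e : polymap_comp (elem_map c e) (elem_map (- c) e) = polymap_id K 2.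
Proof.
apply: eq_from_tnth => i; rewrite !tnth_mktuple; case: eqP => [->|i0].
  rewrite comp_mpolyD comp_mpolyZ rmorphXn /= !comp_mpolyXU -!tnth_nth.
  by rewrite !tnth_mktuple /= scaleNr subrK.
rewrite comp_mpolyXU -tnth_nth tnth_mktuple /=.
by case: (ord2 i) i0 => ->.
Qed.

Lemma elem_map_subproof c e : `[< polymap_invertible (elem_map c e) >].
Proof.
apply/asboolP; exists (elem_map (- c) e); split; first exact: elem_map_comp.
by rewrite -{2}[c]opprK elem_map_comp.
Qed.

Definition elem c e : GA2 := MkGA (elem_map_subproof c e).

Lemma swapM0 F : coord (swap * F)%g 0 = coord F 1.
Proof. by rewrite tnthM tnth_mktuple comp_mpolyXU -tnth_nth subr0. Qed.
Lemma swapM1 F : coord (swap * F)%g 1 = coord F 0.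
Proof. by rewrite tnthM tnth_mktuple comp_mpolyXU -tnth_nth subrr. Qed.
Lemma elemM0 c e F : coord (elem c e * F)%g 0 = coord F 0 + c *: coord F 1 ^+ e.
Proof.
rewrite tnthM tnth_mktuple /= comp_mpolyD comp_mpolyZ rmorphXn /=.
by rewrite !comp_mpolyXU -!tnth_nth.
Qed.
Lemma elemM1 c e F : coord (elem c e * F)%g 1 = coord F 1.
Proof. by rewrite tnthM tnth_mktuple /= comp_mpolyXU -tnth_nth. Qed.

Lemma swap_affine : affine swap.
Proof.
move=> i; rewrite tnth_mktuple; have [->|i0] := eqVneq i 0.
  by exists 0, 1, 0; rewrite subr0 scale0r scale1r mpolyC0 add0r addr0.
exists 1, 0, 0; rewrite scale0r scale1r mpolyC0 !addr0.
by case: (ord2 i) i0 => ->; rewrite ?subrr.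
Qed.

Lemma elem_triangular c e : triangular (elem c e).
Proof.
exists 1, (c *: 'X^e), 1, 0; rewrite !tnth_mktuple /= !scale1r mpolyC0 addr0; split=> //.
rewrite -mul_polyC rmorphM rmorphXn inX1X inX1C.
by rewrite mul_mpolyC.
Qed.

Lemma GA_left_inverse F : exists G : polymap K 2, polymap_comp G F = polymap_id K 2.
Proof. by have [G [_ GF]] := GA_invertible F; exists G. Qed.

(** As long as a component has degree at least 2, [leading_power_automorphism] gives
    an elementary automorphism that lowers the sum of the degrees. *)
Lemma tame F : exists s, letters affine triangular s /\ F = (\prod_(G <- s) G)%g.
Proof.
have [n] := ubnP (size (emb (coord F 0%R)) + size (emb (coord F 1%R)))%N.
elim: n => // n IH in F *; rewrite ltnS => le.
have [G GF] := GA_left_inverse F.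
have [M0 N0 [[M1 N1]|[c [e lt]]|[c [e lt]]]] := leading_power_automorphism GF.
- exists [:: F]; rewrite big_seq1; split => // H; rewrite inE => /eqP ->; left.
  have aff i : (size (emb (coord F i))).-1 = 1%N -> exists al be ga,
      coord F i = al *: 'X_0 + be *: 'X_1 + ga%:MP.
    by move=> e; apply: emb_affine; rewrite -subn_eq0 subn2 e.
  by move=> i; have [->|->] := ord2 i; apply: aff.
- have [F' [F'0 F'1]] : exists F', coord F' 0 = coord F 0 /\
      coord F' 1 = coord F 1 - c *: coord F 0 ^+ e.
    exists (swap * (elem (- c) e * (swap * F)))%g.
    split; first by rewrite (swapM0 (_ * _)%g) elemM1 (swapM1 F).
    by rewrite (swapM1 (_ * _)%g) elemM0 (swapM0 F) (swapM1 F) scaleNr.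
  have [|s [ls sE]] := IH F'.
    rewrite F'0 F'1; apply: leq_trans le; rewrite ltn_add2l.
    by apply: leq_ltn_trans lt _; rewrite ltn_predL (leq_trans N0) ?leq_pred.
  exists [:: swap, elem c e, swap & s]; split.
    move=> H; rewrite !inE => /or4P[/eqP->|/eqP->|/eqP->|/ls //].
    - by left; apply: swap_affine.
    - by right; apply: elem_triangular.
    - by left; apply: swap_affine.
  rewrite !big_cons -sE; apply: GA_eq.
    by rewrite swapM0 elemM1 swapM1 F'0.
  by rewrite swapM1 elemM0 swapM0 swapM1 F'0 F'1 subrK.
have [F' [F'0 F'1]] : exists F', coord F' 0 = coord F 0 - c *: coord F 1 ^+ e /\
    coord F' 1 = coord F 1.
  by exists (elem (- c) e * F)%g; rewrite elemM0 elemM1 scaleNr.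
have [|s [ls sE]] := IH F'.
  rewrite F'0 F'1; apply: leq_trans le; rewrite ltn_add2r.
  by apply: leq_ltn_trans lt _; rewrite ltn_predL (leq_trans M0) ?leq_pred.
exists (elem c e :: s); split.
  move=> H; rewrite !inE => /orP[/eqP->|/ls //]; right; exact: elem_triangular.
rewrite big_cons -sE; apply: GA_eq; last by rewrite elemM1 F'1.
by rewrite elemM0 F'0 F'1 subrK.
Qed.

End Automorphisms.

(** * Automorphisms of finite order *)

Section Finite.
Variable K : fieldType.
Local Notation MP := {mpoly K[2]}.
Local Notation GA2 := (GA K 2).
Local Notation emb := (emb K).
Implicit Types (F G H : GA2) (P : MP).
Local Notation coord F i := (tnth (GAval F) i).
Local Notation affine := (@affine K).
Local Notation triangular := (@triangular K).

Lemma size_coord F i : (1 < size (emb (coord F i)))%N.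
Proof.
have [G GF] := GA_left_inverse F; have [M0 N0 _] := leading_power_automorphism GF.
have [->|->] := ord2 i; [move: M0 | move: N0]; case: (size _) => [|[]] //.
Qed.

Definition lower_first F : Prop := (size (emb (coord F 0%R)) <= size (emb (coord F 1%R)))%N.
Definition lower_second F : Prop := (size (emb (coord F 1%R)) < size (emb (coord F 0%R)))%N.

Lemma affine_not_triangular F : affine F -> ~ triangular F ->
  exists al be ga, al != 0 /\ coord F 1 = al *: 'X_0 + be *: 'X_1 + ga%:MP.
Proof.
move=> aF nt; have [al [be [ga e1]]] := aF 1; exists al, be, ga; split => //.
apply/negP => /eqP al0; apply: nt; have [a [b [c e0]]] := aF 0.
exists a, (b *: 'X + c%:P), be, ga; split; last by rewrite e1 al0 scale0r add0r.
by rewrite e0 -addrA -[b *: 'X]mul_polyC rmorphD rmorphM inX1X !inX1C mul_mpolyC.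
Qed.

Lemma triangular_not_affine F : triangular F -> ~ affine F ->
  exists a (p : {poly K}) b c, [/\ (2 < size p)%N, coord F 0 = a *: 'X_0 + inX1 'X_1 p &
    coord F 1 = b *: 'X_1 + c%:MP].
Proof.
move=> [a [p [b [c [e0 e1]]]]] na; exists a, p, b, c; split => //.
rewrite ltnNge; apply/negP => sp; apply: na => i; have [->|->] := ord2 i; last first.
  by exists 0, b, c; rewrite scale0r add0r.
exists a, p`_1, p`_0; rewrite e0 -addrA; congr (_ + _).
have -> : p = (p`_1)%:P * 'X + (p`_0)%:P.
  apply/polyP => k; rewrite coefD coefCM coefX coefC.
  case: k => [|[|k]] /=; rewrite ?mulr0 ?mulr1 ?add0r ?addr0 //.
  by rewrite nth_default // (leq_trans sp).
rewrite !coefD !coefCM !coefX !coefC /= mulr0 mulr1 add0r addr0.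
by rewrite rmorphD rmorphM inX1X !inX1C mul_mpolyC.
Qed.

Lemma emb_linear F al be ga :
  emb (al *: coord F 0 + be *: coord F 1 + ga%:MP) =
  al%:P *: emb (coord F 0) + be%:P *: emb (coord F 1) + ga%:P%:P.
Proof. by rewrite -!mul_mpolyC !rmorphD !rmorphM !embC !mul_polyC. Qed.

Lemma emb_inX1 P p : emb (inX1 P p) = map_poly polyC p \Po emb P.
Proof.
elim/poly_ind: p => [|p c IH]; first by rewrite !rmorph0.
have -> : inX1 P (p * 'X + c%:P) = inX1 P p * P + c%:MP.
  by rewrite rmorphD rmorphM inX1X inX1C.
have -> : map_poly polyC (p * 'X + c%:P) = map_poly polyC p * 'X + c%:P%:P.
  by rewrite rmorphD rmorphM /= map_polyX map_polyC.
rewrite [LHS]rmorphD rmorphM IH embC.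
by rewrite comp_polyD comp_polyM comp_polyX comp_polyC.
Qed.

(** An affine map that is not triangular has X0 in its second component, and G_0 has
    the larger degree unless G is the identity. *)
Lemma affine_raises F G : onlyA affine triangular F -> G = 1%g \/ lower_second G ->
  lower_first (F * G)%g.
Proof.
move=> [aF nt] hG; have [al [be [ga [al0 e1]]]] := affine_not_triangular aF nt.
have [a [b [c e0]]] := aF 0.
rewrite /lower_first !tnthM e0 e1 !comp_affine !emb_linear.
set u := emb (coord G 0); set w := emb (coord G 1).
have su : (1 < size u)%N := size_coord G 0; have sw : (1 < size w)%N := size_coord G 1.
have wu : (size w <= size u)%N.
  case: hG => [G1|/ltnW //]; rewrite /w /u G1 !tnth1 embX0 embX1.
  by rewrite size_Cmul ?polyX_eq0.
have le : (size (a%:P *: u + b%:P *: w + c%:P%:P)%R <= size u)%N.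
  apply: leq_trans (size_polyD _ _) _; rewrite geq_max; apply/andP; split.
    apply: leq_trans (size_polyD _ _) _; rewrite geq_max size_scale_leq.
    exact: leq_trans (size_scale_leq _ _) wu.
  exact: leq_trans (size_polyC_leq1 _) (ltnW su).
apply: leq_trans le _.
have alP : al%:P != 0 :> {poly K} by rewrite polyC_eq0.
have top : (al%:P *: u + be%:P *: w + ga%:P%:P)`_(size u).-1 != 0.
  rewrite !coefD !coefZ coefC; have -> : ((size u).-1 == 0)%N = false.
    by move: su; case: (size u) => [|[]].
  rewrite addr0; case: hG => [G1|lt].
    rewrite /u /w G1 !tnth1 embX0 embX1 size_Cmul ?polyX_eq0 // size_polyX /=.
    rewrite coefCM coefX /= !mulr1; apply/eqP => /polyP/(_ 1%N)/eqP.
    by rewrite coefD coefCM !coefC coefX /= mulr1 addr0 (negPf al0).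
  rewrite [w`_(size u).-1]nth_default; last first.
    by move: lt; rewrite /lower_second -/u -/w; case: (size u).
  rewrite mulr0 addr0 mulf_neq0 // -lead_coefE lead_coef_eq0 -size_poly_gt0.
  exact: ltnW.
rewrite -(ltn_predK su) ltnNge; apply: contra top => /leq_sizeP ->//.
Qed.

(** A triangular map that is not affine adds to the first component a polynomial of
    degree at least 2 in the second one. *)
Lemma triangular_raises F G : onlyB affine triangular F -> lower_first G ->
  lower_second (F * G)%g.
Proof.
move=> [tF na] hG; have [a [p [b [c [sp e0 e1]]]]] := triangular_not_affine tF na.
rewrite /lower_second !tnthM e0 e1 !comp_mpolyD !comp_mpolyZ comp_inX1 !comp_mpolyXU.
rewrite comp_mpolyC -!tnth_nth.
have -> : b *: coord G 1 + c%:MP = 0 *: coord G 0 + b *: coord G 1 + c%:MP.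
  by rewrite scale0r add0r.
rewrite emb_linear scale0r add0r -mul_mpolyC rmorphD rmorphM embC emb_inX1 mul_polyC.
move: hG; rewrite /lower_first.
have := size_coord G 0; have := size_coord G 1.
set u := emb (coord G 0); set w := emb (coord G 1) => sw su uw.
have sq : (size w < size (map_poly polyC p \Po w)%R)%N.
  have := size_comp_poly (map_poly polyC p) w; rewrite size_map_polyC => e.
  have : ((size p).-1 * (size w).-1 >= 2 * (size w).-1)%N.
    by rewrite leq_mul2r -ltnS (ltn_predK sp) sp orbT.
  rewrite -e; move: sw; move: (size w) (size (map_poly polyC p \Po w)) => k l; lia.
have -> : size (a%:P *: u + (map_poly polyC p \Po w)) = size (map_poly polyC p \Po w).
  rewrite addrC size_polyDl // (leq_ltn_trans (size_scale_leq _ _)) //.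
  exact: leq_ltn_trans uw sq.
apply: leq_ltn_trans sq; apply: leq_trans (size_polyD _ _) _; rewrite geq_max.
by rewrite size_scale_leq; apply: leq_trans (size_polyC_leq1 _) (ltnW sw).
Qed.

(** For a reduced cyclic word of length at least 2, ping-pong shows that the first
    component of each positive power has larger degree than the second one, which is
    not the case for the identity. *)
Lemma finite_order_conjugate F m : (0 < m)%N -> (F ^+ m)%g = 1%g ->
  exists H, affine (F ^ H)%g \/ triangular (F ^ H)%g.
Proof.
move=> m0 Fm; have [s [ls sE]] := tame F.
have [s0|sn] := eqVneq s [::].
  exists 1%g; left; rewrite conjg1 sE s0 big_nil => i; rewrite tnth1.
  have [->|->] := ord2 i; [exists 1, 0, 0|exists 0, 1, 0];
    by rewrite scale1r scale0r mpolyC0 ?addr0 ?add0r.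
have [//|[H [b [r [a [e Bb Aa alt]]]]]] :=
  cyclic_reduction (@affineM K) (@triangularM K) ls sn sE.
have := ping_pong (@affine_raises) (@triangular_raises) m.-1 Bb Aa alt.
rewrite -e prednK // -conjXg Fm conj1g /lower_second !tnth1 embX0 embX1.
by rewrite size_Cmul ?polyX_eq0 // ltnn.
Qed.

End Finite.

(** * The difference operator in characteristic p *)

Section Unipotent.
Variables (K : fieldType) (n p : nat).
Hypothesis charKp : p \in [pchar K].
Implicit Types (F : GA K n) (P : {mpoly K[n]}) (q : {poly K}).

Let p_pr : prime p := pcharf_prime charKp.

(** K[T] acts on polynomials, with T acting as composition with F; then Delta F is
    the action of T - 1. *)
Definition act (F : polymap K n) q P : {mpoly K[n]} :=
  \sum_(i < size q) q`_i *: iter i (comp_mpoly F) P.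

Lemma actE (F : polymap K n) m q P : (size q <= m)%N ->
  act F q P = \sum_(i < m) q`_i *: iter i (comp_mpoly F) P.
Proof.
move=> le; rewrite /act (big_ord_widen m (fun i => q`_i *: iter i (comp_mpoly F) P)) //.
rewrite big_mkcond; apply: eq_bigr => i _; case: ltnP => // ge.
by rewrite nth_default // scale0r.
Qed.

Lemma iter_compB (F : polymap K n) i P Q :
  iter i (comp_mpoly F) (P - Q) = iter i (comp_mpoly F) P - iter i (comp_mpoly F) Q.
Proof. by elim: i => //= i ->; rewrite rmorphB. Qed.

Lemma act_XsubC1 (F : polymap K n) q P : act F (q * ('X - 1)) P = act F q (Delta F P).
Proof.
have s1 : (size (q * ('X - 1))%R <= (size q).+1)%N.
  apply: leq_trans (size_polyMleq _ _) _; rewrite -polyC1 size_XsubC; lia.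
rewrite (actE F P s1) (actE F (Delta F P) (leqnSn (size q))).
transitivity (
   \sum_(i < (size q).+1)
     ((if i == 0 :> nat then 0 else q`_i.-1) *: iter i (comp_mpoly F) P)
   - \sum_(i < (size q).+1) q`_i *: iter i (comp_mpoly F) P).
  rewrite -sumrB; apply: eq_bigr => i _.
  by rewrite mulrBr mulr1 coefB coefMX scalerBl.
rewrite big_ord_recl /= scale0r add0r.
rewrite [X in _ - X]big_ord_recr /= [RHS]big_ord_recr /= !nth_default // !scale0r !addr0.
rewrite -sumrB; apply: eq_bigr => i _; rewrite /Delta iter_compB scalerBr.
by rewrite -iterSr.
Qed.

Lemma iter_Delta_act (F : polymap K n) m P :
  iter m (Delta F) P = act F (('X - 1) ^+ m) P.
Proof.
elim: m P => [|m IH] P.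
  by rewrite expr0 /act size_poly1 big_ord1 coefC scale1r.
by rewrite iterSr IH exprSr act_XsubC1.
Qed.

Lemma iter_comp F m P : iter m (comp_mpoly (GAval F)) P = P \mPo GAval (F ^+ m)%g.
Proof.
elim: m => [|m IH] /=; first by rewrite comp_mpoly_id.
by rewrite IH mPoA expgSr.
Qed.

(** This is (T - 1)^(p^k) = T^(p^k) - 1, read through the action of K[T]. *)
Lemma iter_Delta_pchar F k P :
  iter (p ^ k) (Delta F) P = (P \mPo GAval (F ^+ (p ^ k))%g) - P.
Proof.
rewrite iter_Delta_act.
have -> : ('X - 1 : {poly K}) ^+ (p ^ k) = 'X^(p ^ k) - 1.
  have cp : p \in [pchar {poly K}] by rewrite pchar_poly.
  have pn : [pchar {poly K}].-nat (p ^ k)%N by rewrite pnatX pnatE ?cp.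
  by rewrite exprDn_pchar // exprNn_pchar // expr1n.
have m0 : (0 < p ^ k)%N by rewrite expn_gt0 prime_gt0.
set m := (p ^ k)%N in m0 *.
have sm : (size ('X^m - 1 : {poly K})%R <= m.+1)%N.
  by rewrite -polyC1 size_XnsubC.
rewrite (actE _ _ sm) -iter_comp; case: m m0 {sm} => // m _.
rewrite big_ord_recr big_ord_recl big1 /= => [|i _]; last first.
  rewrite coefB coefXn coef1 /bump /= add1n eqSS ltn_eqF ?ltn_ord //.
  by rewrite subrr scale0r.
rewrite !coefB !coefXn !coef1 eqxx /= sub0r subr0 scaleN1r scale1r addr0.
exact: addrC.
Qed.

Lemma expg_pchar_eq1 F k :
  (F ^+ (p ^ k))%g = 1%g <-> forall i, iter (p ^ k) (Delta F) 'X_i = 0.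
Proof.
split=> [F1 i|D0].
  by rewrite iter_Delta_pchar F1 comp_mpoly_id subrr.
apply: val_inj; apply: eq_from_tnth => i; rewrite [RHS]tnth_mktuple.
have /eqP := D0 i; rewrite iter_Delta_pchar subr_eq0 => /eqP <-.
by rewrite comp_mpolyXU -tnth_nth.
Qed.

Lemma Delta0 (F : polymap K n) : Delta F 0 = 0.
Proof. by rewrite /Delta rmorph0 subrr. Qed.

Lemma iter_Delta0 (F : polymap K n) m : iter m (Delta F) 0 = 0.
Proof. by elim: m => //= m ->; rewrite Delta0. Qed.

Lemma DeltaC (F : polymap K n) c : Delta F c%:MP = 0.
Proof. by rewrite /Delta comp_mpolyC subrr. Qed.

Lemma iter_Delta_ge (F : polymap K n) m m' P : (m <= m')%N ->
  iter m (Delta F) P = 0 -> iter m' (Delta F) P = 0.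
Proof. by move=> le e; rewrite -(subnK le) iterD e iter_Delta0. Qed.

End Unipotent.

(** * The exponent of p-power torsion *)

(** With determinant 0, the Cayley-Hamilton theorem says that N ^ 2 = tr N * N. *)
Lemma nilpotent_mx2 (K : fieldType) (N : 'M[K]_2) m : N ^+ m.+1 = 0 -> N ^+ 2 = 0.
Proof.
move=> Nm; have det0 : \det N = 0.
  have : \det (N ^+ m.+1) = 0 by rewrite Nm det0.
  rewrite -[N]/(N : 'M_2); move=> h; apply/eqP.
  have -> : (\det N == 0) = (\det N ^+ m.+1 == 0) by rewrite expf_eq0.
  suff -> : \det N ^+ m.+1 = \det (N ^+ m.+1) by rewrite h.
  elim: m {Nm h} => [|m IH]; first by rewrite !expr1.
  by rewrite exprS IH [in RHS]exprS -mulmxE det_mulmx.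
pose t := N 0 0 + N 1 1.
have N2 : N ^+ 2 = t *: N.
  have d0 : N 0 0 * N 1 1 = N 0 1 * N 1 0.
    apply/eqP; rewrite -subr_eq0 -[X in _ == X]det0 (expand_det_row _ 0).
    rewrite !big_ord_recl big_ord0 addr0 /cofactor !det_mx11 !mxE /=.
    have -> : lift 0 0 = 1 :> 'I_2 by apply: val_inj.
    have -> : lift 1 0 = 0 :> 'I_2 by apply: val_inj.
    by apply/eqP; rewrite /bump /= expr0 expr1 mul1r mulN1r mulrN.
  rewrite expr2 -mulmxE; apply/matrixP => i j; rewrite !mxE !big_ord_recl big_ord0 addr0.
  rewrite lift01.
  rewrite /t; have [->|->] := ord2 i; have [->|->] := ord2 j; ring: d0.
have Nt k : N ^+ k.+1 = t ^+ k *: N.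
  elim: k => [|k IH]; first by rewrite expr1 scale1r.
  by rewrite exprSr IH -scalerAl -expr2 N2 scalerA -exprSr.
move: Nm; rewrite Nt => /eqP; rewrite scaler_eq0 expf_eq0 => /orP[/andP[_ /eqP t0]|/eqP N0].
  by rewrite N2 t0 scale0r.
by rewrite N2 N0 scaler0.
Qed.

Section Exponent.
Variables (K : fieldType) (p : nat).
Hypothesis charKp : p \in [pchar K].
Local Notation MP := {mpoly K[2]}.
Local Notation GA2 := (GA K 2).
Implicit Types (F G H : GA2) (P : MP).
Local Notation coord F i := (tnth (GAval F) i).
Local Notation affine := (@affine K).
Local Notation triangular := (@triangular K).

Let p_pr : prime p := pcharf_prime charKp.

(** On affine polynomials modulo constants, Delta F is a nilpotent 2 x 2 matrix, so
    its square is 0. Hence the third power of Delta F kills the coordinates, and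
    3 <= p ^ 2. *)
Lemma affine_exponent F k : affine F -> (F ^+ (p ^ k))%g = 1%g -> (F ^+ (p ^ 2))%g = 1%g.
Proof.
move=> aF /(expg_pchar_eq1 charKp) D0; apply/(expg_pchar_eq1 charKp) => i.
have [a0 [b0 [c0 e0]]] := aF 0; have [a1 [b1 [c1 e1]]] := aF 1.
pose l (r : 'rV[K]_2) c : MP := r 0 0 *: 'X_0 + r 0 1 *: 'X_1 + c%:MP.
pose N : 'M[K]_2 := \matrix_(i, j)
  (if i == 0 then (if j == 0 then a0 - 1 else b0) else (if j == 0 then a1 else b1 - 1)).
have Dl r c : exists c', Delta F (l r c) = l (r *m N) c'.
  exists (r 0 0 * c0 + r 0 1 * c1); rewrite /Delta /l comp_affine e0 e1.
  have rN j : (r *m N) 0 j = r 0 0 * N 0 j + r 0 1 * N 1 j.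
    rewrite mxE !big_ord_recl big_ord0 addr0.
    by rewrite lift01.
  rewrite !rN !mxE /= -!mul_mpolyC !(mpolyCD, mpolyCM, mpolyCB, mpolyC1); ring.
have iterl m r c : exists c', iter m (Delta F) (l r c) = l (r *m (N ^+ m)) c'.
  elim: m => [|m [c' IH]]; first by exists c; rewrite expr0 mulmx1.
  have [c'' e] := Dl (r *m (N ^+ m)) c'; exists c''.
  by rewrite iterS IH e -mulmxA mulmxE -exprSr.
have l0 r c : l r c = 0 -> r = 0.
  move=> lr; apply/matrixP => i0 j; rewrite [i0]ord1 mxE.
  have cf mu : (l r c)@_mu = r 0 0 * (mu == U_(0%R)%MM)%:R +
      r 0 1 * (mu == U_(1%R)%MM)%:R + c * (mu == 0%MM)%:R.
    by rewrite /l !mcoeffD !mcoeffZ !mcoeffX mcoeffC ![_ == mu]eq_sym.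
  have n01 : (U_(0%R) == U_(1%R) :> 'X_{1..2})%MM = false.
    by apply/negP => /eqP/mnmP/(_ 0); rewrite !mnm1E.
  have n0 (v : 'I_2) : (U_(v) == 0 :> 'X_{1..2})%MM = false.
    by apply/negP => /eqP/mnmP/(_ v); rewrite mnm1E mnm0E eqxx.
  have [->|->] := ord2 j.
    by have := cf U_(0%R)%MM; rewrite lr mcoeff0 eqxx n01 n0 !mulr0 mulr1 !addr0.
  by have := cf U_(1%R)%MM; rewrite lr mcoeff0 eqxx eq_sym n01 n0 !mulr0 mulr1 addr0 add0r.
have Xl j : 'X_j = l (delta_mx 0 j) 0.
  rewrite /l mpolyC0 addr0 !mxE /=; have [->|->] := ord2 j; rewrite /=.
    by rewrite scale1r scale0r addr0.
  by rewrite scale1r scale0r add0r.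
have Np : N ^+ (p ^ k) = 0.
  apply/row_matrixP => j; rewrite rowE row0.
  have [c' e] := iterl (p ^ k)%N (delta_mx 0 j) 0.
  by apply: (l0 _ c'); rewrite -e -Xl D0.
have N2 : N ^+ 2 = 0.
  apply: (nilpotent_mx2 (m := (p ^ k).-1)).
  by rewrite prednK // expn_gt0 prime_gt0.
have D3 : iter 3 (Delta F) 'X_i = 0.
  have [c' e] := iterl 2%N (delta_mx 0 i) 0.
  by rewrite iterS Xl e N2 mulmx0 /l !mxE !scale0r !add0r DeltaC.
apply: iter_Delta_ge D3; apply: leq_trans (_ : 2 ^ 2 <= _)%N => //.
by rewrite leq_exp2r // prime_gt1.
Qed.

Lemma pexp_root_unity (a : K) k : a ^+ (p ^ k) = 1 -> a = 1.
Proof.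
move=> e; apply/eqP; rewrite -subr_eq0.
have pn : [pchar K].-nat (p ^ k)%N by rewrite pnatX pnatE ?charKp.
have : (a - 1) ^+ (p ^ k) == 0.
  by rewrite exprDn_pchar // exprNn_pchar // expr1n e subrr.
by rewrite expf_eq0 => /andP[].
Qed.

(** The diagonal coefficients a and b have p-power order, so they are 1. Then F ^ p
    fixes X1 and adds to X0 a polynomial in X1, which it also fixes. *)
Lemma triangular_exponent F k :
  triangular F -> (F ^+ (p ^ k))%g = 1%g -> (F ^+ (p ^ 2))%g = 1%g.
Proof.
move=> [a [q [b [c [F0 F1]]]]] Fk.
have pow m : exists qm cm, coord (F ^+ m)%g 0 = a ^+ m *: 'X_0 + inX1 'X_1 qm /\
    coord (F ^+ m)%g 1 = b ^+ m *: 'X_1 + cm%:MP.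
  elim: m => [|m [qm [cm [e0 e1]]]].
    by exists 0, 0; rewrite !expg0 !tnth1 !expr0 !scale1r rmorph0 mpolyC0 !addr0.
  exists (a ^+ m *: q + (qm \Po (b *: 'X + c%:P))), (b ^+ m * c + cm).
  rewrite expgSr !tnthM e0 e1 !comp_mpolyD !comp_mpolyZ comp_inX1 !comp_mpolyXU.
  rewrite comp_mpolyC -!tnth_nth F0 F1; split; last first.
    by rewrite exprSr -!mul_mpolyC !mpolyCD !mpolyCM; ring.
  have -> : inX1 'X_1 (a ^+ m *: q + (qm \Po (b *: 'X + c%:P))) =
      (a ^+ m)%:MP * inX1 'X_1 q + inX1 (b *: 'X_1 + c%:MP) qm.
    by rewrite -inX1_comp -[_ *: q]mul_polyC rmorphD rmorphM inX1C.
  by rewrite exprSr -!mul_mpolyC !mpolyCM; ring.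
have [qk [ck []]] := pow (p ^ k)%N; rewrite Fk !tnth1 => E0 E1.
have ev (v : 'I_2 -> K) (r : {poly K}) : (inX1 'X_1 r).@[v] = r.[v 1].
  elim/poly_ind: r => [|r d IH]; first by rewrite rmorph0 meval0 horner0.
  rewrite rmorphD rmorphM inX1X inX1C mevalD mevalM IH mevalXU mevalC.
  by rewrite hornerMXaddC.
(* the values at a unit vector and at 0 isolate a, and then b *)
have a1 : a = 1.
  apply: (@pexp_root_unity _ k).
  have := congr1 (meval (fun i => (i == 0)%:R)) E0.
  have := congr1 (meval (fun i => 0)) E0.
  rewrite !mevalD !mevalZ !ev !mevalXU /= mulr0 mulr1 add0r => <-.
  by rewrite addr0.
have b1 : b = 1.
  apply: (@pexp_root_unity _ k).
  have := congr1 (meval (fun i => (i == 1)%:R)) E1.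
  have := congr1 (meval (fun i => 0)) E1.
  rewrite !mevalD !mevalZ !mevalC !mevalXU /= mulr0 mulr1 add0r => <-.
  by rewrite addr0.
have p2 : (2 <= p)%N := prime_gt1 p_pr.
have p1E := expn1 p.
have H1 : coord (F ^+ p)%g 1 = 'X_1.
  have D2 : iter 2 (Delta F) 'X_1 = 0.
    by rewrite /= {2}/Delta comp_mpolyXU -tnth_nth F1 b1 scale1r addrAC subrr add0r DeltaC.
  have := iter_Delta_pchar charKp F 1 'X_1; rewrite p1E (iter_Delta_ge p2 D2).
  by move/esym/eqP; rewrite subr_eq0 comp_mpolyXU -tnth_nth => /eqP.
have [s [d [H0 _]]] := pow p; rewrite a1 expr1n scale1r in H0.
rewrite (_ : p ^ 2 = p * p ^ 1)%N ?expn1 ?mulnn // expgnA -p1E.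
apply/(expg_pchar_eq1 charKp) => i; rewrite p1E; apply: (iter_Delta_ge p2).
have [->|->] := ord2 i; rewrite /= {2}/Delta comp_mpolyXU -tnth_nth.
  rewrite H0 addrAC subrr add0r /Delta comp_inX1 comp_mpolyXU -tnth_nth H1.
  by rewrite subrr.
by rewrite H1 subrr Delta0.
Qed.

Lemma p_power_exponent F k : (F ^+ (p ^ k))%g = 1%g -> (F ^+ (p ^ 2))%g = 1%g.
Proof.
move=> Fk; have pk0 : (0 < p ^ k)%N by rewrite expn_gt0 prime_gt0.
have [H HF] := finite_order_conjugate pk0 Fk.
have Hk : ((F ^ H) ^+ (p ^ k))%g = 1%g by rewrite -conjXg Fk conj1g.
have H2 : ((F ^ H) ^+ (p ^ 2))%g = 1%g.
  by case: HF => h; [apply: affine_exponent Hk | apply: triangular_exponent Hk].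
by rewrite -[LHS](conjgK H) conjXg H2 conj1g.
Qed.

End Exponent.

Theorem proposition4p3 (K : fieldType) (p : nat) (charKp : p \in [pchar K]%R) :
  (forall (F : GA K 2) (k : nat),
      eltorder F = Some (p ^ k)%N -> (p ^ k %| p ^ 2)%N)
  /\
  (forall F : GA K 2,
      pascal_finite F -> leoo (pascal_depth F) (Some (p ^ 2)%N)).
Proof.
have p_pr := pcharf_prime charKp.
have p2_gt0 : (0 < p ^ 2)%N by rewrite expn_gt0 prime_gt0.
split=> [F k|F].
  move=> /minposP[_ /eqP Fk kmin].
  have le := kmin _ p2_gt0 (introT eqP (p_power_exponent charKp Fk)).
  by rewrite dvdn_exp2l // -(leq_exp2l _ _ (prime_gt1 p_pr)).
rewrite /pascal_finite /pascal_depth !big_ord_recl big_ord0.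
rewrite lift01.
case e0: (pascal_depth_at F 'X_ord0) => [m0|] //.
case e1: (pascal_depth_at F 'X_1) => [m1|] // _.
have [m0_gt0 /eqP D0 min0] := (minposP _ _).1 e0.
have [m1_gt0 /eqP D1 min1] := (minposP _ _).1 e1.
have Fk : (F ^+ (p ^ (m0 + m1)))%g = 1%g.
  have le : (m0 + m1 <= p ^ (m0 + m1))%N by rewrite ltnW // ltn_expl // prime_gt1.
  apply/(expg_pchar_eq1 charKp) => i; have [->|->] := ord2 i.
    by apply: iter_Delta_ge D0; apply: leq_trans le; rewrite leq_addr.
  by apply: iter_Delta_ge D1; apply: leq_trans le; rewrite leq_addl.
have /(expg_pchar_eq1 charKp) D := p_power_exponent charKp Fk.
rewrite /= !geq_max leq0n andbT.
by rewrite min0 ?min1 ?D.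
Qed.
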